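(* Let $\tilde\gamma>0$, $\tilde\mu>0$ and $\tilde\beta<0$, and let $h(x,t)$ be the transition density described in the context. Then $$\overline h(x):=\lim_{t\to+\infty}h(x,t)=\frac{1}{\Gamma(\tilde\gamma)}\left(\frac{|\tilde\beta|}{\tilde\mu}\right)^{\tilde\gamma}x^{\tilde\gamma-1}\exp\left(-x\,\frac{|\tilde\beta|}{\tilde\mu}\right),\qquad x\in\mathbb R^+.$$
   Context: $\mathbb R^+=(0,\infty)$. For each $t>0$, $h(\cdot,t)$ is a probability density on $\mathbb R^+$: the transition density, started from state $0$, of the temporally homogeneous diffusion on $\mathbb R^+$ with drift $\tilde\beta x+\tilde\gamma\tilde\mu$ and infinitesimal variance $2\tilde\mu x$ with zero-flux condition at $x=0$. That is, $h$ satisfies, for $x\in\mathbb R^+$ and $t>0$, the Fokker–Planck equation $$\frac{\partial}{\partial t}h(x,t)=-\frac{\partial}{\partial x}\left\{(\tilde\beta x+\tilde\gamma\tilde\mu)h(x,t)\right\}+\frac12\frac{\partial^2}{\partial x^2}\left\{2\tilde\mu x\,h(x,t)\right\},$$ with boundary condition $$\lim_{x\to0^+}\left\{(\tilde\beta x+\tilde\gamma\tilde\mu)h(x,t)-\frac12\frac{\partial}{\partial x}\left[2\tilde\mu x\,h(x,t)\right]\right\}=0$$ and initial condition $\lim_{t\to0^+}h(x,t)=\delta(x)$ (the Dirac delta at $0$, i.e. weak convergence of the corresponding probability measures to the unit mass at $0$). *)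

(* Defs.v *)
From HB Require Import structures.
From mathcomp Require Import all_boot all_order all_algebra.
From mathcomp Require Import all_classical all_reals all_analysis.

Set Implicit Arguments.
Unset Strict Implicit.
Unset Printing Implicit Defensive.

Import Order.TTheory GRing.Theory Num.Theory.
Import numFieldNormedType.Exports.

Local Open Scope ring_scope.
Local Open Scope classical_set_scope.

Definition Gamma (R : realType) (a : R) : R :=
  \int[@lebesgue_measure R]_(x in `]0, +oo[) (x `^ (a - 1) * expR (- x)).

Definition is_density (R : realType) (f : R -> R) : Prop :=
  [/\ measurable_fun (`]0, +oo[ : set R) f,
      forall x : R, 0 < x -> 0 <= f x &
      (\int[@lebesgue_measure R]_(x in `]0%R, +oo[) (f x)%:E = 1)%E].

(* All functions h : R -> R -> R below are read as h x t (space, then time);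
   their values outside x > 0, t > 0 play no role. *)

Definition continuous_quadrant (R : realType) (g : R -> R -> R) : Prop :=
  forall x t : R, 0 < x -> 0 < t ->
    {for (x, t), continuous (fun p : R * R => g p.1 p.2)}.

(* h is of class C^{2,1} on x > 0, t > 0: the regularity of a classical solution.
   Differentiability is required explicitly because derive1 is a total operator. *)
Definition class_C21 (R : realType) (h : R -> R -> R) : Prop :=
  [/\ forall x t : R, 0 < x -> 0 < t ->
        [/\ derivable (h x) t 1, derivable (h^~ t) x 1
          & derivable (derive1 (h^~ t)) x 1],
      continuous_quadrant h,
      continuous_quadrant (fun x t => derive1 (h x) t),
      continuous_quadrant (fun x t => derive1 (h^~ t) x) &
      continuous_quadrant (fun x t => derive1n 2 (h^~ t) x)].

Definition drift (R : realType) (beta gamma mu : R) (x : R) : R :=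
  beta * x + gamma * mu.

Definition inf_variance (R : realType) (mu : R) (x : R) : R := 2 * mu * x.

Definition fokker_planck (R : realType) (beta gamma mu : R) (h : R -> R -> R) :
    Prop :=
  forall x t : R, 0 < x -> 0 < t ->
    derive1 (h x) t =
      - derive1 (fun y => drift beta gamma mu y * h y t) x
      + 2^-1 * derive1n 2 (fun y => inf_variance mu y * h y t) x.

Definition zero_flux_at_0 (R : realType) (beta gamma mu : R) (h : R -> R -> R) :
    Prop :=
  forall t : R, 0 < t ->
    (drift beta gamma mu x * h x t
      - 2^-1 * derive1 (fun y => inf_variance mu y * h y t) x) @[x --> 0^'+] --> 0.

(* Weak convergence of h(x,t) dx to the unit mass at 0. The laws live on
   [0, +oo[; bounded continuous test functions there are exactly the
   restrictions of those on R. *)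
Definition initial_dirac0 (R : realType) (h : R -> R -> R) : Prop :=
  forall f : R -> R, continuous f -> (exists M : R, forall x, `|f x| <= M) ->
    (\int[@lebesgue_measure R]_(x in `]0, +oo[) (f x * h x t)) @[t --> 0^'+]
      --> f 0.

Record transition_density_from0 (R : realType) (beta gamma mu : R)
    (h : R -> R -> R) : Prop := TransitionDensityFrom0 {
  td_density : forall t : R, 0 < t -> is_density (h^~ t);
  td_regular : class_C21 h;
  td_fokker_planck : fokker_planck beta gamma mu h;
  td_zero_flux : zero_flux_at_0 beta gamma mu h;
  td_initial : initial_dirac0 h }.

(* Main.v *)
(* Test the Fokker-Planck equation, whose generator is
   [L f = (beta x + gamma mu) f' + mu x f''], against
   [psi x t = c t * (e^(- s t x) - 1)], where [s' = - beta s + mu s^2] and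
   [c' = gamma mu s c], so that [psi_t + L psi = - c'].  Since [psi] vanishes at
   [x = 0], the cutoffs near [0] and [+oo] disappear in the limit by dominated
   convergence, and since the mass of [h _ t] is 1 for all [t], the quantity
   [c t * int e^(- s t x) h x t dx] is constant in time; its value comes from
   the initial condition.  Hence [h _ T] has the Laplace transform
   [(1 + sigma / r)^(- gamma)] of the gamma density of shape [gamma] and rate
   [r = |beta| / (mu (1 - e^(beta T)))].  Laplace transforms determine continuous
   functions, so [h _ T] is this density, and [r] tends to [|beta| / mu]. *)

Require Import Defs.
From mathcomp Require Import all_boot all_order all_algebra.
From mathcomp Require Import all_classical all_reals all_analysis.
From mathcomp Require Import measurable_realfun.
From mathcomp Require Import ring lra.
Import Order.TTheory GRing.Theory Num.Theory.
Import numFieldNormedType.Exports.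
Local Open Scope ring_scope.
Local Open Scope classical_set_scope.

(** Integrability over the half-line is known for [h] alone, not for its derivatives. So every space
    derivative is moved to the test function on a compact interval, and what results must be bounded
    uniformly in the cutoff [chi], so that a multiple of [h] dominates. This dictates a cutoff
    written in [a / x] and [x / b]: then [x chi'] and [x^2 chi''] are bounded independently of [a]
    and [b], and the generator meets the cutoff only through [beta psi (x chi')],
    [gamma mu (psi / x) (x chi')], [2 mu psi' (x chi')] and [mu (psi / x) (x^2 chi'')]. The quotient
    [psi / x] is bounded because of the [- 1] in [psi]. The cutoff is removed in the identity
    integrated over [[t1, T]] with [t1 > 0], so the full integral is never differentiated in time.
    As [t1] tends to 0 the exponent [s t1] moves, while the initial condition concerns a fixed test
    function; the gap is closed by a squeeze, the Laplace transform being decreasing in its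
    exponent. *)

(** * Integrability and dominated convergence for real-valued integrals *)

Lemma integrable_bounded_mul {d} {T : measurableType d} {R : realType}
    (mu : {measure set T -> \bar R}) (D : set T) (f g : T -> R) (K : R) :
  measurable D -> measurable_fun D g -> (forall x, D x -> `|g x| <= K) ->
  mu.-integrable D (EFin \o f) ->
  mu.-integrable D (EFin \o (fun x => g x * f x)).
Proof.
move=> mD mg gK fi.
have := integrableMr mD mg _ fi; apply => /=.
exists K; split; first exact: num_real.
by move=> M KM x Dx; apply: (le_trans (gK x Dx)); exact: ltW.
Qed.

Lemma Rintegral_dominated_cvg {d} {T : measurableType d} {R : realType}
    (mu : {measure set T -> \bar R}) (D : set T) (f_ : nat -> T -> R)
    (f g : T -> R) :
  measurable D -> (forall n, measurable_fun D (f_ n)) ->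
  (forall x, D x -> f_ n x @[n --> \oo] --> f x) ->
  mu.-integrable D (EFin \o g) ->
  (forall n x, D x -> `|f_ n x| <= g x) ->
  \int[mu]_(x in D) f_ n x @[n --> \oo] --> \int[mu]_(x in D) f x.
Proof.
move=> mD mf ff ig fg.
have mff : measurable_fun D f by exact: (measurable_fun_cvg mf).
have [||||intf _ cv] := @dominated_convergence _ _ _ mu _ mD
  (fun n x => (f_ n x)%:E) (EFin \o f) (EFin \o g) _ _ _ ig _.
- by move=> n; exact/measurable_EFinP.
- exact/measurable_EFinP.
- by apply: aeW => x Dx; apply: cvg_EFin; [exact: nearW|exact: ff].
- by apply: aeW => x n Dx; rewrite lee_fin; exact: fg.
rewrite /Rintegral; apply: fine_cvg; rewrite fineK//.
exact: integrable_fin_num.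
Qed.

Lemma integrable_nonneg_EFin {d} {T : measurableType d} {R : realType}
    (mu : {measure set T -> \bar R}) (D : set T) (f : T -> R) :
  measurable D -> measurable_fun D f -> (forall x, D x -> 0 <= f x) ->
  (\int[mu]_(x in D) (f x)%:E < +oo)%E -> mu.-integrable D (EFin \o f).
Proof.
move=> mD mf f0 fy; apply/integrableP; split; first exact/measurable_EFinP.
rewrite (eq_integral (fun x => (f x)%:E)) // => x /set_mem Dx /=.
by rewrite ger0_norm ?f0.
Qed.

Lemma integrable_EFin_add {d} {T : measurableType d} {R : realType}
    (mu : {measure set T -> \bar R}) (D : set T) (f g : T -> R) :
  measurable D -> mu.-integrable D (EFin \o f) ->
  mu.-integrable D (EFin \o g) ->
  mu.-integrable D (EFin \o (fun x => f x + g x)).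
Proof. by move=> mD fi gi; have := integrableD mD fi gi. Qed.

Lemma integrable_EFin_mull {d} {T : measurableType d} {R : realType}
    (mu : {measure set T -> \bar R}) (D : set T) (k : R) (f : T -> R) :
  measurable D -> mu.-integrable D (EFin \o f) ->
  mu.-integrable D (EFin \o (fun x => k * f x)).
Proof. by move=> mD; exact: (integrable_bounded_mul mu D f (cst k) `|k|). Qed.

(** * Lebesgue measure under dilations *)

Section scaling.
Context {R : realType}.
Notation mu := (@lebesgue_measure R).

Let scale (l : R) : measurableTypeR R -> measurableTypeR R := *%R l.

Let measurable_scale (l : R) : measurable_fun setT (scale l).
Proof. exact: mulrl_measurable. Qed.

(** Packages the pushforward as a bundled measure with its defining equation, so that lemmas on
    measures apply to [nu] while the equation recovers the pushforward. *)
Let scaled_lebesgue (l : R) : 0 < l ->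
  {nu : {measure set (measurableTypeR R) -> \bar R} |
    (nu : set _ -> \bar R) = pushforward mu (scale l)}.
Proof.
move=> l0; unshelve eexists (pushforward mu (scale l)) => //.
Qed.

(** By uniqueness of Lebesgue measure: the preimage of []a, b]] has length [(b - a) / l], so [l]
    times the pushforward gives every such interval its length. *)
Lemma lebesgue_measure_scale (l : R) (A : set (measurableTypeR R)) : 0 < l ->
  measurable A -> mu A = (l%:E * mu (( *%R l) @^-1` A))%E.
Proof.
move=> l0 mA; have [nu nuE] := scaled_lebesgue l l0.
pose k : {nonneg R} := NngNum (ltW l0).
have kE X : mscale k nu X = (l%:E * mu (scale l @^-1` X))%E.
  exact: (congr1 (fun z => l%:E * z)%E (congr1 (@^~ X) nuE)).
transitivity (mscale k nu A); last exact: kE.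
apply: lebesgue_measure_unique => // _ [[a b]] _ <-.
rewrite [RHS]kE.
have -> : scale l @^-1` `]a, b]%classic = `]a / l, b / l]%classic.
  apply/seteqP; split => x /=; rewrite !in_itv/= ltr_pdivrMr// ler_pdivlMr//;
  by rewrite /scale mulrC.
rewrite !lebesgue_measure_itv/= !lte_fin ltr_pM2r ?invr_gt0//.
case: ifP => _; last by rewrite mule0.
by rewrite -!EFinB -EFinM -mulrBl mulrC divfK ?gt_eqF.
Qed.

(** Nonnegative functions and extended reals make this usable before the right-hand integral is
    known to be finite. *)
Lemma integral_scale_pos (l : R) (f : R -> R) : 0 < l ->
  measurable_fun setT f -> (forall x, 0 <= f x) ->
  (\int[mu]_(x in `]0%R, +oo[) (f x)%:E
   = l%:E * \int[mu]_(x in `]0%R, +oo[) (f (l * x)%R)%:E)%E.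
Proof.
move=> l0 mf f0; have [nu nuE] := scaled_lebesgue l l0.
have -> : (\int[mu]_(x in `]0%R, +oo[) (f x)%:E =
    \int[mscale (NngNum (ltW l0)) nu]_(x in `]0%R, +oo[) (f x)%:E)%E.
  apply: eq_measure_integral => A mA _.
  apply: (etrans (lebesgue_measure_scale l A l0 mA)).
  exact: (congr1 (fun z => l%:E * z)%E (congr1 (@^~ A) (esym nuE))).
have mfE : measurable_fun [set: measurableTypeR R] (EFin \o f).
  exact/measurable_EFinP.
rewrite ge0_integral_mscale//=; last 2 first.
  - exact: measurable_funTS.
  - by move=> x _; rewrite lee_fin.
congr (_ * _)%E; rewrite nuE ge0_integral_pushforward//=.
- congr (integral _ _ _); apply/seteqP.
  by split => x /=; rewrite !in_itv/= !andbT /scale pmulr_rgt0.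
- exact: measurable_funTS.
- by move=> x _; rewrite lee_fin.
Qed.

End scaling.

Lemma measurable_expRNM {R : realType} (D : set R) (a : R) :
  measurable_fun D (fun x => expR (- (a * x))).
Proof.
apply: measurable_funTS; apply: measurableT_comp => //.
by apply: measurableT_comp => //; exact: mulrl_measurable.
Qed.

Lemma integrable_laplace {R : realType} (f : R -> R) (a : R) : 0 <= a ->
  (@lebesgue_measure R).-integrable `]0, +oo[ (EFin \o f) ->
  (@lebesgue_measure R).-integrable `]0, +oo[
    (EFin \o (fun x => expR (- (a * x)) * f x)).
Proof.
move=> a0; apply: (integrable_bounded_mul (@lebesgue_measure R) _ f _ 1) => //.
  exact: measurable_expRNM.
move=> x; rewrite /= in_itv/= andbT => x0.
by rewrite ger0_norm ?expR_ge0// -expR0 ler_expR oppr_le0 mulr_ge0// ltW.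
Qed.

(** * Fundamental theorem of calculus and derivative rules *)

Section calculus.
Context {R : realType}.
Notation mu := (@lebesgue_measure R).

Lemma is_derive_continuous (F : R -> R) (x d : R) :
  is_derive x 1 F d -> {for x, continuous F}.
Proof.
by move=> FD; apply: differentiable_continuous; apply/derivable1_diffP; case: FD.
Qed.

Lemma integral_is_derive (f F : R -> R) (a b : R) : a < b ->
  (forall x, a <= x <= b -> is_derive x 1 F (f x)) ->
  (forall x, a <= x <= b -> {for x, continuous f}) ->
  (\int[mu]_(x in `[a, b]) (f x)%:E = (F b - F a)%:E)%E.
Proof.
move=> ab FD fc; rewrite EFinB (@continuous_FTC2 _ f F)//.
- by apply: continuous_in_subspaceT => x /[!inE] /= xab; apply: fc.
- have FC x : a <= x <= b -> {for x, continuous F}.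
    by move=> /FD; exact: is_derive_continuous.
  split.
  + move=> x /[!in_itv]/= /andP[ax xb].
    by case: (FD x); rewrite ?ltW ?(ltW ax) ?(ltW xb).
  + by apply: cvg_at_right_filter; apply: FC; rewrite lexx ltW.
  + by apply: cvg_at_left_filter; apply: FC; rewrite lexx ltW.
- move=> x /[!in_itv]/= /andP[ax xb]; rewrite derive1E.
  by apply: derive_val; apply: FD; rewrite !ltW.
Qed.

Lemma is_derive_inv (x : R) : x != 0 ->
  is_derive x 1 (fun y => y^-1) (- x ^- 2).
Proof.
move=> x0; apply: DeriveDef; first exact: derivableV.
by rewrite (@deriveV _ _ id)// derive_id /GRing.scale/= mulr1.
Qed.

(** This rule and the next ones are phrased with explicit [fun y => ...] and ordinary products, so
    that long derivatives can be assembled as proof terms and their values then normalised by [ring]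
    or [field]. *)
Lemma is_derive_const (k x : R) : is_derive x 1 (fun _ : R => k) 0.
Proof. exact: is_derive_cst. Qed.

Lemma is_derive_add (f g : R -> R) (x df dg : R) :
  is_derive x 1 f df -> is_derive x 1 g dg ->
  is_derive x 1 (fun y => f y + g y) (df + dg).
Proof. exact: is_deriveD. Qed.

Lemma is_derive_sub (f g : R -> R) (x df dg : R) :
  is_derive x 1 f df -> is_derive x 1 g dg ->
  is_derive x 1 (fun y => f y - g y) (df - dg).
Proof. exact: is_deriveB. Qed.

Lemma is_derive_mul (f g : R -> R) (x df dg : R) :
  is_derive x 1 f df -> is_derive x 1 g dg ->
  is_derive x 1 (fun y => f y * g y) (df * g x + f x * dg).
Proof.
move=> fD gD; apply: is_derive_eq (is_deriveM fD gD) _.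
by rewrite /GRing.scale/= addrC; congr (_ + _); rewrite mulrC.
Qed.

Lemma is_derive_mull (k : R) (f : R -> R) (x df : R) :
  is_derive x 1 f df -> is_derive x 1 (fun y => k * f y) (k * df).
Proof.
move=> fD; apply: is_derive_eq (is_derive_mul (cst k) f x 0 df _ fD) _.
by rewrite mul0r add0r.
Qed.

Lemma is_derive_chain (f g : R -> R) (x df dg : R) :
  is_derive (g x) 1 f df -> is_derive x 1 g dg ->
  is_derive x 1 (fun y => f (g y)) (df * dg).
Proof. exact: is_derive1_comp. Qed.

End calculus.

(** * Exhaustion of the half-line by compact intervals *)

Section exhaust.
Context {R : realType}.

(** The right end is [n.+2] because [n.+1] would make the interval degenerate at [n = 0]. *)
Definition exhaust (n : nat) : set R := `[n.+1%:R^-1, n.+2%:R].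

Lemma exhaust_pos (n : nat) (x : R) : exhaust n x -> 0 < x.
Proof. by rewrite /exhaust/= in_itv/= => /andP[nx _]; exact: lt_le_trans nx. Qed.

Lemma near_exhaust (x : R) : 0 < x -> \forall n \near \oo, exhaust n x.
Proof.
(* [n + 1 >= x + 1/x] yields both [x <= n + 1] and [1/x <= n + 1]. *)
move=> x0; exists (Num.trunc (x + x^-1)) => // n /= Nn.
have xn : x + x^-1 <= n.+1%:R.
  apply: le_trans (ltW (truncnS_gt (x + x^-1))) _.
  by rewrite ler_nat ltnS.
rewrite /exhaust/= in_itv/=; apply/andP; split.
  rewrite invf_ple ?posrE//; apply: le_trans xn.
  by rewrite lerDr ltW.
apply: (@le_trans _ _ n.+1%:R); last by rewrite ler_nat.
by apply: le_trans xn; rewrite lerDl invr_ge0 ltW.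
Qed.

End exhaust.

(** * Convergence of the Gamma integral and the Laplace transform of a power *)

Section gamma_integral.
Context {R : realType} (c : R).
Hypothesis c_gt0 : 0 < c.
Notation mu := (@lebesgue_measure R).
Notation pos := (`]0, +oo[ : set R).

(** This is [(x / (1 + x)) ^ c], with values in [[0, 1]]: its derivative has integral at most 1 over
    any interval, yet behaves like [c x^(c - 1)] near 0. One comparison function thus serves at both
    ends of the half-line. *)
Let primitive (x : R) := (1 + x^-1) `^ (- c).
Let bound (x : R) := c * (x ^- 2 * (1 + x^-1) `^ (- c - 1)).

Let is_derive_primitive (x : R) : 0 < x ->
  is_derive x 1 primitive (bound x).
Proof.
move=> x0.
have x1 : 0 < 1 + x^-1 by rewrite addr_gt0// invr_gt0.
have xi : is_derive x 1 (fun y : R => 1 + y^-1) (- x ^- 2).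
  have := is_derive_add (cst 1) _ x _ _ _ (is_derive_inv x (lt0r_neq0 x0)).
  by move=> /(_ 0 _); rewrite add0r; apply.
have := is_derive_chain (fun z => z `^ (- c)) _ x _ _ (is_derive1_powR (- c) x1) xi.
by move=> h; apply: is_derive_eq h _; rewrite /bound; ring.
Qed.

Let continuous_bound (x : R) : 0 < x -> {for x, continuous bound}.
Proof.
move=> x0.
have x1 : 0 < 1 + x^-1 by rewrite addr_gt0// invr_gt0.
have xV : {for x, continuous (fun y : R => y^-1)}.
  exact: (is_derive_continuous _ _ _ (is_derive_inv x (lt0r_neq0 x0))).
have xD : {for x, continuous (fun y : R => 1 + y^-1)}.
  by apply: cvgD; [exact: cvg_cst|exact: xV].
apply: cvgM; first exact: cvg_cst.
apply: cvgM.
  rewrite -exprVn; under eq_fun do rewrite -exprVn.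
  by apply: (@cvgM _ _ _ _ _ _ _ _ xV xV).
apply: (@continuous_comp _ _ _ (fun y : R => 1 + y^-1)
  (fun z => z `^ (- c - 1))) => //.
exact: (is_derive_continuous _ _ _ (is_derive1_powR (- c - 1) x1)).
Qed.

(* [1 + x <= (c + 1) e^(x / (c + 1))] makes the integrand at most a multiple of
   the derivative of [(x / (1 + x)) `^ c]. *)
Let integrand_le (x : R) : 0 < x ->
  x `^ (c - 1) * expR (- x) <= (c + 1) `^ (c + 1) / c * bound x.
Proof.
move=> x0; set m := c + 1.
have m0 : 0 < m by rewrite addr_gt0.
have -> : m `^ m / c * bound x = m `^ m * (x `^ (c - 1) * (1 + x) `^ (- m)).
  rewrite /bound; have -> : 1 + x^-1 = (1 + x) * x^-1.
    by rewrite mulrDl mul1r divff ?gt_eqF// addrC.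
  rewrite powRM ?invr_ge0 ?addr_ge0// ?ltW//.
  have -> : - c - 1 = - m by rewrite /m opprD.
  have -> : (x^-1) `^ (- m) = x `^ m.
    by rewrite -powR_inv1 ?ltW// -powRrM mulN1r opprK.
  have -> : x ^- 2 * ((1 + x) `^ (- m) * x `^ m) =
      (x `^ m * x ^- 2) * (1 + x) `^ (- m) by ring.
  have -> : x `^ m * x ^- 2 = x `^ (c - 1).
    rewrite -powR_invn ?ltW// -powRD ?(gt_eqF x0) ?implybT//.
    by congr (_ `^ _); rewrite /m; ring.
  by rewrite mulrA divfK ?gt_eqF.
rewrite mulrCA ler_wpM2l ?powR_ge0// powRN ler_pdivlMr ?powR_gt0 ?addr_gt0//.
rewrite expRN ler_pdivrMl ?expR_gt0// mulrC.
have -> : m `^ m * expR x = (m * expR (x / m)) `^ m.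
  rewrite powRM ?expR_ge0 ?ltW//; congr (_ * _).
  by rewrite /powR gt_eqF ?expR_gt0// expRK mulrC divfK ?gt_eqF.
apply: ge0_ler_powR.
- exact: ltW.
- by rewrite nnegrE addr_ge0// ltW.
- by rewrite nnegrE mulr_ge0 ?expR_ge0// ltW.
apply: (@le_trans _ _ (m * (1 + x / m))).
  rewrite mulrDr mulr1 mulrCA divff ?gt_eqF// mulr1 lerD2r.
  by rewrite /m lerDr ltW.
by rewrite ler_wpM2l ?expR_ge1Dx// ltW.
Qed.

Let integral_bound_le (a b : R) : 0 < a -> a < b ->
  (\int[mu]_(x in `[a, b]) (bound x)%:E <= 1%:E)%E.
Proof.
move=> a0 ab.
have dF x : a <= x <= b -> is_derive x 1 primitive (bound x).
  by move=> /andP[ax _]; apply: is_derive_primitive; exact: lt_le_trans ax.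
have cf x : a <= x <= b -> {for x, continuous bound}.
  by move=> /andP[ax _]; apply: continuous_bound; exact: lt_le_trans ax.
rewrite (integral_is_derive bound primitive a b ab dF cf) lee_fin lerBlDr.
apply: (@le_trans _ _ 1); last by rewrite lerDl powR_ge0.
have b0 : 0 < b by exact: lt_trans ab.
rewrite /primitive powRN invf_le1 ?powR_gt0 ?addr_gt0 ?invr_gt0//.
rewrite -[leLHS](powRr0 (1 + b^-1)); apply: ler_powR; last exact: ltW.
by rewrite lerDl invr_ge0 ltW.
Qed.

Let integrand (x : R) := x `^ (c - 1) * expR (- x).

Lemma measurable_gamma_integrand : measurable_fun setT integrand.
Proof.
apply: measurable_funM; first exact: measurable_powR.
by apply: measurableT_comp => //; exact: measurableT_comp.
Qed.

(** Monotone convergence along [exhaust]: on each compact interval the integral is at most the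
    constant [(c + 1)^(c + 1) / c] of [integrand_le]. *)
Lemma integrable_gamma : mu.-integrable pos (EFin \o integrand).
Proof.
apply: integrable_nonneg_EFin => //.
- by apply: measurable_funTS; exact: measurable_gamma_integrand.
- by move=> x _; rewrite mulr_ge0 ?powR_ge0 ?expR_ge0.
have posE : pos = \bigcup_n exhaust n.
  apply/seteqP; split => [x|x [n _ /exhaust_pos x0]]; last first.
    by rewrite /= in_itv/= x0.
  rewrite /= in_itv/= andbT => /near_exhaust[n _ nx].
  by exists n => //; exact: nx (leqnn n).
have mI : measurable_fun setT (EFin \o integrand).
  by apply/measurable_EFinP; exact: measurable_gamma_integrand.
have : (\int[mu]_(x in exhaust n) (integrand x)%:E @[n --> \oo] -->
    \int[mu]_(x in \bigcup_n exhaust n) (integrand x)%:E)%E.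
  apply: ge0_nondecreasing_set_cvg_integral.
  - move=> m n mn; apply/subsetPset => x; rewrite /exhaust/= !in_itv/=.
    move=> /andP[mx xm]; apply/andP; split.
      by rewrite (le_trans _ mx)// lef_pV2 ?posrE// ler_nat.
    by rewrite (le_trans xm)// ler_nat.
  - by move=> n; exact: measurable_itv.
  - by move=> n; exact: measurable_funTS.
  - by move=> n x _; rewrite lee_fin mulr_ge0 ?powR_ge0 ?expR_ge0.
rewrite -posE => cvI.
set K := (c + 1) `^ (c + 1) / c.
apply: (@le_lt_trans _ _ K%:E); last exact: ltry.
rewrite -(cvg_lim _ cvI)//; apply: lime_le; first by apply/cvg_ex; eexists; exact: cvI.
apply: nearW => n.
have n0 : 0 < n.+1%:R^-1 :> R by rewrite invr_gt0.
have nn : n.+1%:R^-1 < n.+2%:R :> R.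
  rewrite (@le_lt_trans _ _ 1)// ?invf_le1//; first by rewrite ler1n.
  by rewrite ltr1n.
have K0 : 0 <= K by rewrite divr_ge0 ?powR_ge0// ltW.
have bound0 x : 0 < x -> 0 <= bound x.
  by move=> x0; rewrite !mulr_ge0 ?powR_ge0 ?invr_ge0 ?sqr_ge0// ltW.
have mb : measurable_fun (exhaust n) bound.
  apply: subspace_continuous_measurable_fun; first exact: measurable_itv.
  apply: continuous_in_subspaceT => x /set_mem Fx.
  by apply: continuous_bound; exact: exhaust_pos Fx.
apply: (@le_trans _ _ (\int[mu]_(x in exhaust n) (K * bound x)%:E)%E).
  apply: ge0_le_integral => //.
  - exact: measurable_itv.
  - by move=> x _; rewrite lee_fin mulr_ge0 ?powR_ge0 ?expR_ge0.
  - exact: measurable_funTS.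
  - by apply/measurable_EFinP; apply: measurable_funM.
  - by move=> x Fx; have x0 := exhaust_pos n x Fx; rewrite lee_fin integrand_le.
under eq_integral do rewrite EFinM.
rewrite ge0_integralZl//.
- by rewrite -[leRHS]mule1 lee_pmul2l ?lte_fin ?divr_gt0 ?powR_gt0 ?addr_gt0
    ?integral_bound_le.
- exact: measurable_itv.
- exact/measurable_EFinP.
- by move=> x Fx; have x0 := exhaust_pos n x Fx; rewrite lee_fin bound0.
Qed.

(** The dilation by [l] expresses the finite Gamma integral as [l^c] times this one, where
    [l^c = l l^(c - 1)]. Being an identity of extended reals, it gives integrability and value
    together. *)
Lemma gamma_laplace (l : R) : 0 < l ->
  let f x := x `^ (c - 1) * expR (- (l * x)) in
  mu.-integrable pos (EFin \o f) /\
  \int[mu]_(x in pos) f x = Gamma c * l `^ (- c).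
Proof.
move=> l0 f.
have mf : measurable_fun setT f.
  apply: measurable_funM; first exact: measurable_powR.
  exact: measurable_expRNM.
have f0 x : 0 <= f x by rewrite mulr_ge0 ?powR_ge0 ?expR_ge0.
have lc : (\int[mu]_(x in pos) (integrand x)%:E =
    (l `^ c)%:E * \int[mu]_(x in pos) (f x)%:E)%E.
  rewrite (integral_scale_pos l)//; first last.
  - by move=> x; rewrite mulr_ge0 ?powR_ge0 ?expR_ge0.
  - exact: measurable_gamma_integrand.
  have -> : (\int[mu]_(x in pos) (integrand (l * x))%:E =
      \int[mu]_(x in pos) ((l `^ (c - 1))%:E * (f x)%:E))%E.
    apply: eq_integral => x; rewrite inE/= in_itv/= andbT => x0.
    by rewrite -EFinM /integrand powRM ?ltW// -mulrA.
  rewrite ge0_integralZl//=.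
  - rewrite muleA -EFinM; congr (_%:E * _)%E.
    by rewrite mulr_powRB1// ltW.
  - by apply/measurable_EFinP; exact: measurable_funTS.
  - by move=> x _; rewrite lee_fin.
  - by rewrite lee_fin powR_ge0.
have ifin : (\int[mu]_(x in pos) (integrand x)%:E \is a fin_num)%E.
  exact: (integrable_fin_num _ integrable_gamma).
have fE : (\int[mu]_(x in pos) (f x)%:E = (Gamma c * l `^ (- c))%:E)%E.
  rewrite EFinM /Gamma /Rintegral fineK// muleC lc muleA -EFinM.
  by rewrite powRN mulVf ?mul1e// gt_eqF// powR_gt0.
split; last by rewrite /Rintegral fE.
by apply: integrable_nonneg_EFin; rewrite ?fE ?ltry//; exact: measurable_funTS.
Qed.

End gamma_integral.

(** * Injectivity of the Laplace transform on continuous integrable functions *)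

Section laplace_uniqueness.
Context {R : realType} (f : R -> R).
Notation mu := (@lebesgue_measure R).
Notation pos := (`]0, +oo[ : set R).
Hypothesis f_int : mu.-integrable pos (EFin \o f).
(** Integer exponents suffice: by linearity [f] is then orthogonal to every polynomial in
    [e^(-x)]. *)
Hypothesis f_laplace0 : forall n : nat,
  \int[mu]_(x in pos) (expR (- (n%:R * x)) * f x) = 0.

Let kernel (y0 : R) (n : nat) (x : R) := (1 - (expR (- x) - y0) ^+ 2) ^+ n.

Let measurable_kernel (y0 : R) (n : nat) : measurable_fun pos (kernel y0 n).
Proof.
apply: measurable_funX; apply: measurable_funB => //.
apply: measurable_funX; apply: measurable_funB => //.
by apply: measurable_funTS; exact: measurableT_comp.
Qed.

Let base_bounds (y0 x : R) : 0 < y0 < 1 -> 0 < x ->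
  0 <= 1 - (expR (- x) - y0) ^+ 2 <= 1.
Proof.
move=> /andP[y00 y01] x0.
have e0 : 0 < expR (- x) by exact: expR_gt0.
have e1 : expR (- x) < 1 by rewrite -expR0 ltr_expR oppr_lt0.
rewrite gerBl sqr_ge0 andbT subr_ge0 -[leRHS](expr1n _ 2%N).
by rewrite -[leLHS]real_normK ?num_real// lerXn2r ?nnegrE// ler_norml; lra.
Qed.

Let kernel_bounds (y0 x : R) (n : nat) : 0 < y0 < 1 -> 0 < x ->
  0 <= kernel y0 n x <= 1.
Proof.
move=> y01 x0; have /andP[b0 b1] := base_bounds y0 x y01 x0.
by rewrite exprn_ge0// exprn_ile1.
Qed.

Let exp_kernel_int (y0 : R) (n k : nat) : 0 < y0 < 1 ->
  mu.-integrable pos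
    (EFin \o (fun x => (expR (- (k%:R * x)) * kernel y0 n x) * f x)).
Proof.
move=> y01; apply: (integrable_bounded_mul mu pos f _ 1) => //.
  by apply: measurable_funM; [exact: measurable_expRNM|exact: measurable_kernel].
move=> x; rewrite /= in_itv/= andbT => x0.
have /andP[k0 k1] := kernel_bounds y0 x n y01 x0.
rewrite ger0_norm ?mulr_ge0 ?expR_ge0// mulr_ile1 ?expR_ge0//.
by rewrite -expR0 ler_expR oppr_le0 mulr_ge0// ltW.
Qed.

(** Induction on [n] for all [k] at once: with [y = e^(-x)], one factor of the kernel is
    [(1 - y0^2) + 2 y0 y - y^2], which raises [k] by 0, 1 or 2. *)
Let exp_kernel_integral0 (y0 : R) (n k : nat) : 0 < y0 < 1 ->
  \int[mu]_(x in pos) ((expR (- (k%:R * x)) * kernel y0 n x) * f x) = 0.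
Proof.
move=> y01; elim: n k => [|n IH] k.
  rewrite -[RHS](f_laplace0 k); apply: eq_Rintegral => x _.
  by rewrite /kernel expr0 mulr1.
pose I j x := (expR (- (j%:R * x)) * kernel y0 n x) * f x.
have Iint j : mu.-integrable pos (EFin \o I j) by exact: exp_kernel_int.
have Iz j (c : R) : mu.-integrable pos (EFin \o (fun x => c * I j x)).
  exact: (integrable_EFin_mull mu pos).
transitivity (\int[mu]_(x in pos)
    (((1 - y0 ^+ 2) * I k x + 2 * y0 * I k.+1 x) - I k.+2 x)).
  apply: eq_Rintegral => x _; rewrite /I /kernel exprS.
  have E j : expR (- (j.+1%:R * x)) = expR (- (j%:R * x)) * expR (- x).
    by rewrite -expRD; congr expR; rewrite -natr1; ring.
  by rewrite !E; ring.
rewrite RintegralB//; last first.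
  by apply: (integrable_EFin_add mu pos); [|exact: Iz|exact: Iz].
by rewrite RintegralD// !RintegralZl// !IH !mulr0 addr0 subr0.
Qed.

(* The kernel [(1 - (e^(-x) - e^(-x0))^2)^n] is a polynomial in [e^(-x)] whose
   mass concentrates at [x0]. *)
Lemma laplace0_le0 (x0 : R) : 0 < x0 -> {for x0, continuous f} -> f x0 <= 0.
Proof.
move=> x00 cf; rewrite leNgt; apply/negP => fx0.
pose y0 := expR (- x0).
have y01 : 0 < y0 < 1.
  by rewrite /y0 expR_gt0 /= -expR0 ltr_expR oppr_lt0.
(* The bound [x0 / 2] keeps the window around [x0] inside the half-line. *)
have [d d0 df] : exists2 d : R, 0 < d <= x0 / 2 &
    forall x, `|x - x0| < d -> f x0 / 2 <= f x.
  have : \forall x \near x0, f x0 / 2 <= f x.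
    move/cvgrPdist_lt : cf => /(_ (f x0 / 2)) /=.
    rewrite divr_gt0// => /(_ isT); apply: filterS => x.
    by rewrite ltr_norml => /andP[_]; lra.
  move=> /nbhs_ballP[e /= e0 ef]; exists (Num.min e (x0 / 2)).
    by rewrite lt_min e0 divr_gt0//= ge_min lexx orbT.
  move=> x; rewrite lt_min => /andP[xe _]; apply: ef.
  by rewrite /ball/= distrC.
have /andP[d_gt0 dx0] := d0.
(* Outside the window of radius [d], [e^(-x)] stays at distance at least [eta] from [y0]; on a
   smaller window of radius [d'] it is within [eta / 2]. The base of the kernel is therefore at most
   [r] far away and at least [r' > r] close to [x0]. *)
pose eta := Num.min (y0 - expR (- (x0 + d))) (expR (- (x0 - d)) - y0).
have eta0 : 0 < eta by rewrite lt_min !subr_gt0 !ltr_expR; lra.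
have far x : d <= `|x - x0| -> eta <= `|expR (- x) - y0|.
  move=> dx.
  have etal : eta <= y0 - expR (- (x0 + d)) by rewrite ge_min lexx.
  have etar : eta <= expR (- (x0 - d)) - y0 by rewrite ge_min lexx orbT.
  have /orP[h|h] : (d <= x - x0) || (d <= - (x - x0)) by rewrite -ler_normr.
    have : expR (- x) <= expR (- (x0 + d)) by rewrite ler_expR; lra.
    by move=> hx; rewrite distrC (le_trans _ (ler_norm _))//; lra.
  have : expR (- (x0 - d)) <= expR (- x) by rewrite ler_expR; lra.
  by move=> hx; rewrite (le_trans _ (ler_norm _))//; lra.
have [d' d'0 near'] : exists2 d' : R, 0 < d' <= d &
    forall x, `|x - x0| < d' -> `|expR (- x) - y0| <= eta / 2.
  have : {for x0, continuous (fun x : R => expR (- x))}.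
    apply: (@continuous_comp _ _ _ -%R expR); first exact: continuousN.
    exact: continuous_expR.
  move/cvgrPdist_le => /(_ (eta / 2)); rewrite divr_gt0// => /(_ isT).
  move=> /nbhs_ballP[e /= e0 ef]; exists (Num.min e d).
    by rewrite lt_min e0 d_gt0/= ge_min lexx orbT.
  move=> x; rewrite lt_min => /andP[xe _]; rewrite distrC; apply: ef.
  by rewrite /ball/= distrC.
have /andP[d'_gt0 d'd] := d'0.
pose r := 1 - eta ^+ 2; pose r' := 1 - (eta / 2) ^+ 2.
have eta1 : eta <= 1.
  have /andP[_ y1] := y01; have := expR_ge0 (- (x0 + d)).
  have : eta <= y0 - expR (- (x0 + d)) by rewrite ge_min lexx.
  by lra.
have r0 : 0 <= r by rewrite /r; nra.
have rr' : r < r' by rewrite /r /r'; nra.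
pose U : set R := `]x0 - d', x0 + d'[.
pose I := \int[mu]_(x in pos) `|f x|.
have I0 : 0 <= I by exact: Rintegral_ge0.
have Uint : mu.-integrable pos (EFin \o (\1_U : R -> R)).
  by apply: integrableS (integrable_indic_itv _ _ _ _).
have fa : mu.-integrable pos (EFin \o (fun x => `|f x|)).
  exact: integrable_norm.
have IU : \int[mu]_(x in pos) (\1_U x) = 2 * d'.
  rewrite /Rintegral integral_indic//.
  have -> : U `&` pos = U.
    by apply/setIidPl => x; rewrite /U/= !in_itv/= andbT => /andP[h _]; lra.
  have /= -> := lebesgue_measure_itv (`]x0 - d', x0 + d'[%R : interval R).
    by rewrite lte_fin ifT/=; lra.
  exact: measurable_itv.
(* Integrate the pointwise bound [A 1_U <= kernel f + r^n |f|], in which the kernel term has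
   integral 0. Far from [x0] the term [r^n |f|] absorbs a negative [kernel f]; inside the window of
   radius [d], [f] is positive. *)
have key n : r' ^+ n * (f x0 / 2) * (2 * d') <= r ^+ n * I.
  have k0 := exp_kernel_integral0 y0 n 0%N y01.
  have kint := exp_kernel_int y0 n 0%N y01.
  pose A := r' ^+ n * (f x0 / 2).
  have UintA : mu.-integrable pos (EFin \o (fun x => A * \1_U x)).
    exact: (integrable_EFin_mull mu pos).
  have faint : mu.-integrable pos (EFin \o (fun x => r ^+ n * `|f x|)).
    exact: (integrable_EFin_mull mu pos).
  have -> : r ^+ n * I = \int[mu]_(x in pos)
      ((expR (- (0%:R * x)) * kernel y0 n x) * f x + r ^+ n * `|f x|).
    by rewrite RintegralD// k0 add0r RintegralZl.
  have -> : A * (2 * d') = \int[mu]_(x in pos) (A * \1_U x).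
    by rewrite RintegralZl ?IU//; exact: Uint.
  apply: le_Rintegral => //; first exact: (integrable_EFin_add mu pos).
  move=> x; rewrite /= in_itv/= andbT => xgt0.
  rewrite mul0r oppr0 expR0 mul1r.
  have /andP[b0 b1] := base_bounds y0 x y01 xgt0.
  have /andP[kx0 kx1] := kernel_bounds y0 x n y01 xgt0.
  have rn0 : 0 <= r ^+ n * `|f x| by rewrite mulr_ge0 ?exprn_ge0.
  have [xd|xd] := leP d `|x - x0|.
    have -> : \1_U x = 0 :> R.
      rewrite indicE memNset// /U/= in_itv/= => h.
      have : `|x - x0| < d' by rewrite ltr_norml; lra.
      by lra.
    rewrite mulr0 -[leLHS](subrr (r ^+ n * `|f x|)) addrC lerD2r.
    rewrite lerNl (le_trans (ler_norm _))// normrN normrM (ger0_norm kx0).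
    rewrite ler_wpM2r// lerXn2r ?nnegrE//.
    rewrite /r lerB// -[leRHS]real_normK ?num_real//.
    by rewrite lerXn2r ?nnegrE ?(ltW eta0)//; exact: far.
  have fx : 0 < f x by have := df x xd; lra.
  apply: (@le_trans _ _ (kernel y0 n x * f x)); last by rewrite lerDl.
  have [xU|xU] := boolP (x \in U); last first.
    by rewrite indicE (negbTE xU) mulr0 mulr_ge0// ltW.
  rewrite indicE xU mulr1 /A.
  have r'0 : 0 <= r' by lra.
  apply: ler_pM; rewrite ?exprn_ge0 ?divr_ge0 ?(ltW fx0)//.
    rewrite lerXn2r ?nnegrE//.
    rewrite /r' lerB// -[leLHS]real_normK ?num_real//.
    rewrite lerXn2r ?nnegrE ?divr_ge0 ?(ltW eta0)//; apply: near'.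
    by move: xU; rewrite inE /U/= in_itv/= ltr_norml; lra.
  exact: df.
(* Dividing [key] by [r' ^+ n] bounds a positive constant by [I q^n], which tends to 0. *)
pose q := r / r'.
have r'0 : 0 < r' by lra.
have q1 : `|q| < 1 by rewrite ger0_norm ?divr_ge0 ?(ltW r'0)// ltr_pdivrMr// mul1r.
have lim0 : I * q ^+ n @[n --> \oo] --> (0 : R) by exact: cvg_geometric.
pose e := f x0 / 2 * (2 * d').
have e0 : 0 < e by rewrite mulr_gt0; lra.
have : e <= 0.
  rewrite -(cvg_lim (@Rhausdorff _) lim0); apply: limr_ge.
    by apply/cvg_ex; eexists; exact: lim0.
  apply: nearW => n; rewrite /q expr_div_n mulrA ler_pdivlMr ?exprn_gt0//.
  by have := key n; rewrite /e; lra.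
by lra.
Qed.

End laplace_uniqueness.

(** * Differentiation under the integral sign in a time strip *)

Section strip.
Context {R : realType} (V : R).
Notation mu := (@lebesgue_measure R).

(** Time is confined to [(0, V)] because the exponent [s] of the test function solves a Riccati
    equation and blows up in finite time. *)
Definition continuous_strip (g : R -> R -> R) :=
  forall x t : R, 0 < x -> 0 < t < V ->
    {for (x, t), continuous (fun p : R * R => g p.1 p.2)}.

Lemma continuous_strip_space (g : R -> R -> R) (x t : R) :
  continuous_strip g -> 0 < x -> 0 < t < V -> {for x, continuous (g^~ t)}.
Proof.
move=> cg x0 tV.
exact: (cvg_comp2 (f := fun y : R => y) (g := cst t) (h := g)
  cvg_id (cvg_cst t) (cg x t x0 tV)).
Qed.

Lemma continuous_strip_time (g : R -> R -> R) (x t : R) :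
  continuous_strip g -> 0 < x -> 0 < t < V -> {for t, continuous (g x)}.
Proof.
move=> cg x0 tV.
exact: (cvg_comp2 (f := cst x) (g := fun s : R => s) (h := g)
  (cvg_cst x) cvg_id (cg x t x0 tV)).
Qed.

Lemma continuous_strip_bounded (g : R -> R -> R) (a b t1 t2 : R) :
  continuous_strip g -> 0 < a -> 0 < t1 -> t2 < V ->
  exists2 K : R, 0 <= K &
    forall x t, a <= x <= b -> t1 <= t <= t2 -> `|g x t| <= K.
Proof.
move=> cg a0 t10 t2V.
pose D : set (R * R) := `[a, b] `*` `[t1, t2].
have cD : compact D by apply: compact_setX; exact: segment_compact.
have cf : {within D, continuous (fun p : R * R => g p.1 p.2)}.
  apply: continuous_in_subspaceT => -[x t] /set_mem[/=].
  rewrite !in_itv/= => /andP[ax _] /andP[t1t tt2].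
  apply: cg; first exact: lt_le_trans ax.
  by rewrite (lt_le_trans t10 t1t) (le_lt_trans tt2 t2V).
have /compact_bounded[M [_ MD]] := continuous_compact cf cD.
exists (`|M| + 1); first by rewrite addr_ge0.
move=> x t xab t12; apply: (MD (`|M| + 1)).
  by rewrite (le_lt_trans (ler_norm M))// ltrDl.
by exists (x, t) => //; split; rewrite /= in_itv.
Qed.

Lemma pos_continuous_integrable (f : R -> R) (a b : R) : 0 < a ->
  (forall x, 0 < x -> {for x, continuous f}) ->
  mu.-integrable `[a, b] (EFin \o f).
Proof.
move=> a0 cf; apply: continuous_compact_integrable; first exact: segment_compact.
apply: continuous_in_subspaceT => x /set_mem/=; rewrite in_itv/= => /andP[ax _].
by apply: cf; exact: lt_le_trans ax.
Qed.

(** On a compact rectangle [F'] is bounded, and a constant dominates. Continuity of the derivative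
    is included because the fundamental theorem of calculus in time requires it. *)
Lemma is_derive_integral_strip (F F' : R -> R -> R) (a b t : R) :
  continuous_strip F -> continuous_strip F' ->
  (forall x t, 0 < x -> 0 < t < V -> is_derive t 1 (F x) (F' x t)) ->
  0 < a -> 0 < t < V ->
  is_derive t 1 (fun s => \int[mu]_(x in `[a, b]) F x s)
    (\int[mu]_(x in `[a, b]) F' x t) /\
  {for t, continuous (fun s => \int[mu]_(x in `[a, b]) F' x s)}.
Proof.
move=> cF cF' dF a0 /andP[t0 tV].
(* [[u, v]] is a compact neighbourhood of [t] inside [(0, V)]. *)
pose u := t / 2; pose v := (t + V) / 2.
have uv s : s \in `]u, v[%R -> 0 < s < V.
  by rewrite in_itv/= /u /v => /andP[us sv]; apply/andP; split; lra.
have tuv : t \in `]u, v[%R by rewrite in_itv/= /u /v; apply/andP; split; lra.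
have [||K K0 KF'] := continuous_strip_bounded F' a b u v cF' a0.
- by rewrite /u; lra.
- by rewrite /v; lra.
have Kint : mu.-integrable `[a, b] (EFin \o cst K).
  by apply: pos_continuous_integrable => // x _; exact: cvg_cst.
have mab : measurable (`[a, b] : set R) by exact: measurable_itv.
have pos (x : R) : `[a, b]%classic x -> 0 < x.
  by rewrite /= in_itv/= => /andP[ax _]; exact: lt_le_trans ax.
have Fint g s : continuous_strip g -> s \in `]u, v[%R ->
    mu.-integrable `[a, b] (EFin \o g^~ s).
  move=> cg /uv sV; apply: pos_continuous_integrable => // x x0.
  exact: continuous_strip_space.
have bd s x : s \in `]u, v[%R -> `[a, b]%classic x -> `|F' x s| <= K.
  rewrite in_itv/= => /andP[us sv]; rewrite /= in_itv/= => xab.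
  by apply: KF' => //; rewrite !ltW.
have F'E s x : s \in `]u, v[%R -> `[a, b]%classic x ->
    partial1of2 (fun s x => F x s) s x = F' x s.
  move=> /uv sV /pos x0; rewrite /partial1of2 derive1E.
  by apply: derive_val; exact: dF.
split; last first.
  apply: (@continuity_under_integral R _ _ mu (fun s x => F' x s) `[a, b] mab
    u v _ _ (cst K)) => //.
  - by move=> s us; exact: Fint.
  - apply: aeW => x xab s /set_mem us.
    by apply: continuous_strip_time => //; [exact: pos|exact: uv].
  - by move=> s us; apply: aeW => x xab; exact: bd.
  - exact: mem_set.
have bdp s x : `]u, v[%classic s -> `[a, b]%classic x ->
    `|partial1of2 (fun s x => F x s) s x| <= K.
  by move=> us xab; rewrite F'E//; exact: bd.
have intF s : `]u, v[%classic s -> mu.-integrable `[a, b] (EFin \o F^~ s).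
  by move=> us; exact: Fint.
have derF s x : `]u, v[%classic s -> `[a, b]%classic x ->
    derivable (F x) s 1.
  by move=> /uv sV /pos x0; case: (dF x s x0 sV).
have D := @derivable_under_integral R _ _ mu (fun s x => F x s) `[a, b] mab
  t u v tuv intF derF (cst K) (fun=> K0) Kint bdp.
have E := @differentiation_under_integral R _ _ mu (fun s x => F x s) `[a, b] mab
  t u v tuv intF derF (cst K) (fun=> K0) Kint bdp.
apply: DeriveDef; first exact: D.
rewrite -derive1E E; apply: eq_Rintegral => x /set_mem xab.
exact: F'E.
Qed.

End strip.

(** * Integration by parts against the generator *)

Section adjoint.
Context {R : realType} (beta gamma mu : R).
Notation leb := (@lebesgue_measure R).

(** [f1] and [f2] are the values at [x] of the first two derivatives, passed as numbers so that
    explicit formulas can be inserted. *)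
Definition generator_at (x f1 f2 : R) : R :=
  drift beta gamma mu x * f1 + mu * x * f2.

(* The boundary terms are collected in [W = - th J - mu x th' u], where
   [J = drift u - mu (x u)'] is the probability flux. *)
Lemma integral_adjoint (a b : R) (u u1 u2 ut th th1 th2 : R -> R) :
  0 < a -> a < b ->
  (forall x : R, 0 < x -> is_derive x 1 u (u1 x)) ->
  (forall x : R, 0 < x -> is_derive x 1 u1 (u2 x)) ->
  (forall x : R, 0 < x -> {for x, continuous u2}) ->
  (forall x : R, 0 < x -> is_derive x 1 th (th1 x)) ->
  (forall x : R, 0 < x -> is_derive x 1 th1 (th2 x)) ->
  (forall x : R, 0 < x -> {for x, continuous th2}) ->
  (forall x : R, 0 < x -> ut x = - (beta * u x + drift beta gamma mu x * u1 x)
    + mu * (2 * u1 x + x * u2 x)) ->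
  th a = 0 -> th1 a = 0 -> th b = 0 -> th1 b = 0 ->
  \int[leb]_(x in `[a, b])
    (th x * ut x - generator_at x (th1 x) (th2 x) * u x) = 0.
Proof.
move=> a0 ab du du1 cu2 dth dth1 cth2 utE tha th1a thb th1b.
(* [ut] is tied to [u] only at [x > 0]; [v] is the same quantity given by a formula whose continuity
   can be read off. *)
pose v x := - (beta * u x + drift beta gamma mu x * u1 x)
    + mu * (2 * u1 x + x * u2 x).
pose w x := th x * v x - generator_at x (th1 x) (th2 x) * u x.
pose W x := th x * (mu * (u x + x * u1 x) - drift beta gamma mu x * u x)
  - mu * (x * (th1 x * u x)).
have did (x : R) : is_derive x 1 (fun y : R => y) 1 by exact: is_derive_id.
have ddrift (x : R) : is_derive x 1 (drift beta gamma mu) beta.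
  apply: is_derive_eq (is_derive_add _ _ x _ _
    (is_derive_mull beta _ x _ (did x)) (is_derive_cst (gamma * mu) x 1)) _.
  by rewrite mulr1 addr0.
have dW (x : R) : 0 < x -> is_derive x 1 W (w x).
  move=> x0.
  have d1 := is_derive_mull mu _ x _ (is_derive_add _ _ x _ _ (du x x0)
    (is_derive_mul _ _ x _ _ (did x) (du1 x x0))).
  have d2 := is_derive_mul _ _ x _ _ (ddrift x) (du x x0).
  have d3 := is_derive_mull mu _ x _ (is_derive_mul _ _ x _ _ (did x)
    (is_derive_mul _ _ x _ _ (dth1 x x0) (du x x0))).
  have d4 := is_derive_sub _ _ x _ _ (is_derive_mul _ _ x _ _ (dth x x0)
    (is_derive_sub _ _ x _ _ d1 d2)) d3.
  apply: is_derive_eq d4 _.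
  by rewrite /w /v /generator_at; ring.
have cu (x : R) : 0 < x -> {for x, continuous u}.
  by move=> /du; exact: is_derive_continuous.
have cu1 (x : R) : 0 < x -> {for x, continuous u1}.
  by move=> /du1; exact: is_derive_continuous.
have cth (x : R) : 0 < x -> {for x, continuous th}.
  by move=> /dth; exact: is_derive_continuous.
have cth1 (x : R) : 0 < x -> {for x, continuous th1}.
  by move=> /dth1; exact: is_derive_continuous.
have cdrift x : {for x, continuous (drift beta gamma mu)}.
  exact: is_derive_continuous.
have cv (x : R) : 0 < x -> {for x, continuous (fun y => th y * v y)}.
  move=> x0; apply: cvgM; first exact: cth.
  apply: cvgD.
    apply: cvgN; apply: cvgD; first by apply: cvgMl_tmp; exact: cu.
    by apply: cvgM; [exact: cdrift|exact: cu1].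
  apply: cvgMl_tmp; apply: cvgD; first by apply: cvgMl_tmp; exact: cu1.
  by apply: cvgM; [exact: cvg_id|exact: cu2].
have cg (x : R) : 0 < x ->
    {for x, continuous (fun y => generator_at y (th1 y) (th2 y) * u y)}.
  move=> x0; apply: cvgM; last exact: cu.
  apply: cvgD; first by apply: cvgM; [exact: cdrift|exact: cth1].
  apply: cvgM; last exact: cth2.
  by apply: cvgMl_tmp; exact: cvg_id.
have cw (x : R) : 0 < x -> {for x, continuous w}.
  by move=> x0; apply: cvgB; [exact: cv|exact: cg].
have pos (x : R) : a <= x <= b -> 0 < x.
  by move=> /andP[ax _]; exact: lt_le_trans ax.
transitivity (\int[leb]_(x in `[a, b]) w x).
  apply: eq_Rintegral => x /set_mem/=; rewrite in_itv/= => /pos x0.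
  by rewrite utE.
rewrite /Rintegral (integral_is_derive w W a b ab
  (fun x xab => dW x (pos x xab)) (fun x xab => cw x (pos x xab))).
by rewrite /= /W tha th1a thb th1b !mul0r !mulr0 subrr.
Qed.

End adjoint.

(** * The cutoff and its scaled derivatives *)

Section cutoff.
Context {R : realType}.

(* [cut0 (a / x) (x / b)] is the cutoff [chi x = (1 - a/x)^2 (1 - x/b)^2];
   [cut1] and [cut2] are [x chi'] and [x^2 chi''] in the same variables. *)
Definition cut0 (p q : R) : R := (1 - p) ^+ 2 * (1 - q) ^+ 2.
Definition cut1 (p q : R) : R :=
  2 * (1 - p) * p * (1 - q) ^+ 2 - 2 * (1 - p) ^+ 2 * (1 - q) * q.
Definition cut2 (p q : R) : R :=
  (6 * p ^+ 2 - 4 * p) * (1 - q) ^+ 2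
  - 8 * (p * (1 - p)) * (q * (1 - q)) + 2 * (1 - p) ^+ 2 * q ^+ 2.

(** Each expression is regrouped into products lying in [[0, 1]]; the constants are the sums of the
    absolute coefficients, [2 + 2] and [6 + 4 + 8 + 2]. *)
Lemma cut_bounds (p q : R) : 0 <= p <= 1 -> 0 <= q <= 1 ->
  [/\ `|cut0 p q| <= 1, `|cut1 p q| <= 4 & `|cut2 p q| <= 20].
Proof.
move=> /andP[p0 p1] /andP[q0 q1].
have sq (z : R) : 0 <= z <= 1 -> 0 <= z ^+ 2 <= 1.
  by move=> /andP[z0 z1]; rewrite sqr_ge0/= expr_le1.
have /andP[P0 P1] : 0 <= (1 - p) ^+ 2 <= 1 by apply: sq; lra.
have /andP[Q0 Q1] : 0 <= (1 - q) ^+ 2 <= 1 by apply: sq; lra.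
have /andP[r0 r1] : 0 <= p ^+ 2 <= 1 by apply: sq; lra.
have /andP[s0 s1] : 0 <= q ^+ 2 <= 1 by apply: sq; lra.
have in01 (y z : R) : 0 <= y <= 1 -> 0 <= z <= 1 -> 0 <= y * z <= 1.
  by move=> /andP[y0 y1] /andP[z0 z1]; rewrite mulr_ge0// mulr_ile1.
have pp : 0 <= p * (1 - p) <= 1 by apply: in01; lra.
have qq : 0 <= q * (1 - q) <= 1 by apply: in01; lra.
have P : 0 <= (1 - p) ^+ 2 <= 1 by rewrite P0.
have Q : 0 <= (1 - q) ^+ 2 <= 1 by rewrite Q0.
have PQ := in01 _ _ P Q.
have ppQ := in01 _ _ pp Q.
have Pqq := in01 _ _ P qq.
have ppqq := in01 _ _ pp qq.
have pQ : 0 <= p * (1 - q) ^+ 2 <= 1 by apply: in01; rewrite ?p0.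
have rQ : 0 <= p ^+ 2 * (1 - q) ^+ 2 <= 1 by apply: in01; rewrite ?r0.
have Ps : 0 <= (1 - p) ^+ 2 * q ^+ 2 <= 1 by apply: in01; rewrite ?s0.
split.
- by rewrite /cut0 ger0_norm; lra.
- have -> : cut1 p q = 2 * (p * (1 - p) * (1 - q) ^+ 2)
      - 2 * ((1 - p) ^+ 2 * (q * (1 - q))) by rewrite /cut1; ring.
  by rewrite ler_norml; lra.
- have -> : cut2 p q = 6 * (p ^+ 2 * (1 - q) ^+ 2) - 4 * (p * (1 - q) ^+ 2)
      - 8 * (p * (1 - p) * (q * (1 - q))) + 2 * ((1 - p) ^+ 2 * q ^+ 2).
    by rewrite /cut2; ring.
  by rewrite ler_norml; lra.
Qed.

Lemma cut_cvg (p_ q_ : nat -> R) :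
  p_ n @[n --> \oo] --> (0 : R) -> q_ n @[n --> \oo] --> (0 : R) ->
  [/\ cut0 (p_ n) (q_ n) @[n --> \oo] --> (1 : R),
      cut1 (p_ n) (q_ n) @[n --> \oo] --> (0 : R) &
      cut2 (p_ n) (q_ n) @[n --> \oo] --> (0 : R)].
Proof.
move=> cp cq.
have cC (k : R) : (fun _ : nat => k) n @[n --> \oo] --> k by exact: cvg_cst.
have c1p : 1 - p_ n @[n --> \oo] --> (1 - 0 : R) by exact: cvgB.
have c1q : 1 - q_ n @[n --> \oo] --> (1 - 0 : R) by exact: cvgB.
have sq (u_ : nat -> R) (l : R) : u_ n @[n --> \oo] --> l ->
  u_ n ^+ 2 @[n --> \oo] --> l ^+ 2 by move=> cu; exact: (cvgM cu cu).
split.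
- have -> : (1 : R) = cut0 0 0 by rewrite /cut0; ring.
  by rewrite /cut0; apply: cvgM; exact: sq.
- have -> : (0 : R) = cut1 0 0 by rewrite /cut1; ring.
  rewrite /cut1; apply: cvgB.
  + apply: cvgM; last exact: sq.
    by apply: cvgM => //; exact: cvgM.
  + apply: cvgM => //; apply: cvgM => //.
    by apply: cvgM => //; exact: sq.
- have -> : (0 : R) = cut2 0 0 by rewrite /cut2; ring.
  rewrite /cut2; apply: cvgD; [apply: cvgB|].
  + apply: cvgM; last exact: sq.
    by apply: cvgB; apply: cvgM => //; exact: sq.
  + by apply: cvgM; [apply: cvgM => //|]; exact: cvgM.
  + by apply: cvgM; [apply: cvgM => //|]; exact: sq.
Qed.

Lemma is_derive_cut (a b x : R) : 0 < x -> b != 0 ->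
  is_derive x 1 (fun y => cut0 (a / y) (y / b)) (cut1 (a / x) (x / b) / x) /\
  is_derive x 1 (fun y => cut1 (a / y) (y / b) / y)
    (cut2 (a / x) (x / b) / x ^+ 2).
Proof.
move=> x0 b0; have xn0 := lt0r_neq0 x0.
have dc (k : R) : is_derive x 1 (fun _ : R => k) 0 by exact: is_derive_cst.
have dV := is_derive_inv x xn0.
have did : is_derive x 1 (fun y : R => y) 1 by exact: is_derive_id.
have dp := is_derive_mull a _ x _ dV.
have dq := is_derive_mul _ _ x _ _ did (dc b^-1).
have d1p := is_derive_sub _ _ x _ _ (dc 1) dp.
have d1q := is_derive_sub _ _ x _ _ (dc 1) dq.
have dP := is_derive_mul _ _ x _ _ d1p d1p.
have dQ := is_derive_mul _ _ x _ _ d1q d1q.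
split.
  have e : is_derive x 1 (fun y => cut0 (a / y) (y / b)) _ :=
    is_derive_mul _ _ x _ _ dP dQ.
  by apply: is_derive_eq e _; rewrite /cut1; field; rewrite ?b0 ?xn0.
have e1 := is_derive_mul _ _ x _ _
  (is_derive_mul _ _ x _ _ (is_derive_mull 2 _ x _ d1p) dp) dQ.
have e2 := is_derive_mul _ _ x _ _
  (is_derive_mul _ _ x _ _ (is_derive_mull 2 _ x _ dP) d1q) dq.
have e : is_derive x 1 (fun y => cut1 (a / y) (y / b) / y) _ :=
  is_derive_mul _ _ x _ _ (is_derive_sub _ _ x _ _ e1 e2) dV.
by apply: is_derive_eq e _; rewrite /cut2; field; rewrite ?b0 ?xn0.
Qed.

End cutoff.

(** * Bounds and limits of integrals along the exhaustion *)

Section exhaustion.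
Context {R : realType}.
Notation mu := (@lebesgue_measure R).
Notation pos := (`]0, +oo[ : set R).

(** Dominated convergence needs a fixed domain, so the dependence on [n] is moved from the domain
    into the integrand, extended by zero. *)
Lemma Rintegral_exhaustE (n : nat) (f : R -> R) :
  \int[mu]_(x in exhaust n) f x = \int[mu]_(x in pos) ((f \_ (exhaust n)) x).
Proof.
rewrite -Rintegral_mkcondr; congr (Rintegral mu _ _).
by apply/esym/setIidPr => x /exhaust_pos x0; rewrite /= in_itv/= x0.
Qed.

Lemma measurable_exhaust_patch (n : nat) (f g : R -> R) :
  (forall x, 0 < x -> {for x, continuous f}) -> measurable_fun pos g ->
  measurable_fun pos ((fun x => f x * g x) \_ (exhaust n)).
Proof.
move=> cf mg; apply/measurable_restrict => //.
  exact: measurable_itv.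
apply: (measurable_funS (E := pos)).
- exact: measurable_itv.
- exact: subIsetl.
apply: measurable_funM => //.
apply: open_continuous_measurable_fun; first exact: interval_open.
by move=> x /set_mem/=; rewrite in_itv/= andbT; exact: cf.
Qed.

Lemma norm_exhaust_patch_le (n : nat) (f g : R -> R) (K : R) : 0 <= K ->
  (forall x, exhaust n x -> `|f x| <= K) ->
  forall x, `|((fun x => f x * g x) \_ (exhaust n)) x| <= K * `|g x|.
Proof.
move=> K0 fK x; rewrite patchE; case: ifPn => [/set_mem nx|_].
  by rewrite normrM ler_wpM2r//; exact: fK.
by rewrite normr0 mulr_ge0.
Qed.

Lemma norm_Rintegral_exhaust_le (n : nat) (f g : R -> R) (K : R) : 0 <= K ->
  mu.-integrable pos (EFin \o g) ->
  (forall x, 0 < x -> {for x, continuous f}) ->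
  (forall x, exhaust n x -> `|f x| <= K) ->
  `|\int[mu]_(x in exhaust n) (f x * g x)| <= K * \int[mu]_(x in pos) `|g x|.
Proof.
move=> K0 gi cf fK.
have mg : measurable_fun pos g.
  by apply/measurable_EFinP; exact: (measurable_int mu).
have gn : mu.-integrable pos (EFin \o (fun x => `|g x|)) by exact: integrable_norm.
have Kg : mu.-integrable pos (EFin \o (fun x => K * `|g x|)).
  exact: (integrable_EFin_mull mu pos).
set P := (fun x => f x * g x) \_ (exhaust n).
have PK := norm_exhaust_patch_le n f g K K0 fK.
have Pi : mu.-integrable pos (EFin \o P).
  apply: le_integrable Kg => //.
    by apply/measurable_EFinP; exact: measurable_exhaust_patch.
  move=> x _ /=; rewrite lee_fin (le_trans (PK x))//.
  exact: ler_norm.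
rewrite Rintegral_exhaustE (le_trans (le_normr_Rintegral _ _))//.
rewrite -RintegralZl//; apply: le_Rintegral => //.
exact: integrable_norm.
Qed.

Lemma Rintegral_exhaust_cvg (f_ : nat -> R -> R) (f g : R -> R) (K : R) :
  0 <= K -> mu.-integrable pos (EFin \o g) ->
  (forall n x, 0 < x -> {for x, continuous (f_ n)}) ->
  (forall n x, exhaust n x -> `|f_ n x| <= K) ->
  (forall x, 0 < x -> f_ n x @[n --> \oo] --> f x) ->
  \int[mu]_(x in exhaust n) (f_ n x * g x) @[n --> \oo] -->
    \int[mu]_(x in pos) (f x * g x).
Proof.
move=> K0 gi cf fK ff.
have mg : measurable_fun pos g.
  by apply/measurable_EFinP; exact: (measurable_int mu).
under eq_fun do rewrite Rintegral_exhaustE.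
apply: (Rintegral_dominated_cvg mu pos _ _ (fun x => K * `|g x|)) => //.
- by move=> n; apply: measurable_exhaust_patch => // x; exact: cf.
- move=> x; rewrite /= in_itv/= andbT => x0.
  have : f_ n x * g x @[n --> \oo] --> f x * g x.
    by apply: cvgMr_tmp; exact: ff.
  apply: cvg_trans; apply: near_eq_cvg.
  near=> n; rewrite patchE mem_set//.
  by near: n; exact: near_exhaust.
- apply: (integrable_EFin_mull mu pos) => //.
  exact: integrable_norm.
- by move=> n x _; apply: norm_exhaust_patch_le => // y; exact: fK.
Unshelve. all: by end_near. Qed.

End exhaustion.

(** * Closure properties of continuity on a strip *)

Section strip_operations.
Context {R : realType} (V : R).

Lemma continuous_strip_mul (f g : R -> R -> R) : continuous_strip V f ->
  continuous_strip V g -> continuous_strip V (fun x t => f x t * g x t).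
Proof.
by move=> cf cg x t x0 tV; apply: cvgM; [exact: cf|exact: cg].
Qed.

Lemma continuous_strip_add (f g : R -> R -> R) : continuous_strip V f ->
  continuous_strip V g -> continuous_strip V (fun x t => f x t + g x t).
Proof.
by move=> cf cg x t x0 tV; apply: cvgD; [exact: cf|exact: cg].
Qed.

Lemma continuous_strip_of_time (f : R -> R) :
  (forall t, 0 < t < V -> {for t, continuous f}) ->
  continuous_strip V (fun _ t => f t).
Proof.
move=> cf x t x0 tV.
apply: (@continuous_comp _ _ _ (fun p : R * R => p.2) f); first exact: cvg_snd.
exact: cf.
Qed.

Lemma continuous_strip_of_space (f : R -> R) :
  (forall x, 0 < x -> {for x, continuous f}) ->
  continuous_strip V (fun x _ => f x).
Proof.
move=> cf x t x0 tV.
apply: (@continuous_comp _ _ _ (fun p : R * R => p.1) f); first exact: cvg_fst.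
exact: cf.
Qed.

Lemma continuous_strip_exp (f : R -> R -> R) : continuous_strip V f ->
  continuous_strip V (fun x t => expR (f x t)).
Proof.
move=> cf x t x0 tV.
apply: (@continuous_comp _ _ _ (fun p : R * R => f p.1 p.2) expR).
  exact: cf.
exact: continuous_expR.
Qed.

End strip_operations.

(** * Pointwise and integral properties of the transition density *)

Section transition_density.
Context {R : realType} (beta gamma mu : R) (h : R -> R -> R).
Hypothesis hh : transition_density_from0 beta gamma mu h.
Notation leb := (@lebesgue_measure R).
Notation pos := (`]0, +oo[ : set R).

Lemma td_integrable (t : R) : 0 < t -> leb.-integrable pos (EFin \o h^~ t).
Proof.
move=> t0; have [mh h0 h1] := td_density hh t0.
apply: integrable_nonneg_EFin => //; last by rewrite h1 ltry.
by move=> x; rewrite /= in_itv/= andbT; exact: h0.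
Qed.

Lemma td_mass (t : R) : 0 < t -> \int[leb]_(x in pos) h x t = 1.
Proof. by move=> t0; have [_ _ h1] := td_density hh t0; rewrite /Rintegral h1. Qed.

Lemma td_ge0 (x t : R) : 0 < x -> 0 < t -> 0 <= h x t.
Proof. by move=> x0 t0; have [_ h0 _] := td_density hh t0; exact: h0. Qed.

Lemma td_is_derive_space (x t : R) : 0 < x -> 0 < t ->
  is_derive x 1 (h^~ t) (derive1 (h^~ t) x) /\
  is_derive x 1 (derive1 (h^~ t)) (derive1n 2 (h^~ t) x).
Proof.
move=> x0 t0; have [/(_ x t x0 t0)[_ d1 d2] _ _ _ _] := td_regular hh.
split; first by rewrite derive1E; exact/derivableP.
have -> : derive1n 2 (h^~ t) x = derive1 (derive1 (h^~ t)) x by [].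
by rewrite derive1E; exact/derivableP.
Qed.

Lemma td_is_derive_time (x t : R) : 0 < x -> 0 < t ->
  is_derive t 1 (h x) (derive1 (h x) t).
Proof.
move=> x0 t0; have [/(_ x t x0 t0)[d1 _ _] _ _ _ _] := td_regular hh.
by rewrite derive1E; exact/derivableP.
Qed.

Lemma td_continuous_space (x t : R) : 0 < x -> 0 < t ->
  {for x, continuous (h^~ t)}.
Proof.
by move=> x0 t0; apply: is_derive_continuous; exact: (td_is_derive_space x t x0 t0).1.
Qed.

Lemma td_fokker_planck_expanded (x t : R) : 0 < x -> 0 < t ->
  derive1 (h x) t =
    - (beta * h x t + drift beta gamma mu x * derive1 (h^~ t) x)
    + mu * (2 * derive1 (h^~ t) x + x * derive1n 2 (h^~ t) x).
Proof.
move=> x0 t0; rewrite (td_fokker_planck hh x0 t0).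
have did (y : R) : is_derive y 1 (fun z : R => z) 1 by exact: is_derive_id.
have ddrift (y : R) : is_derive y 1 (drift beta gamma mu) beta.
  apply: is_derive_eq (is_derive_add _ _ y _ _
    (is_derive_mull beta _ y _ (did y)) (is_derive_cst (gamma * mu) y 1)) _.
  by rewrite mulr1 addr0.
have dvar (y : R) : is_derive y 1 (inf_variance mu) (2 * mu).
  by apply: is_derive_eq (is_derive_mull (2 * mu) _ y _ (did y)) _; rewrite mulr1.
have [hx hxx] := td_is_derive_space x t x0 t0.
rewrite [X in - X]derive1E.
rewrite [X in - X](@derive_val _ _ _ _ _ _ _
  (is_derive_mul _ _ x _ _ (ddrift x) hx)).
have d1 (y : R) : 0 < y ->
    derive1 (fun y => inf_variance mu y * h y t) y =
    2 * mu * h y t + inf_variance mu y * derive1 (h^~ t) y.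
  move=> y0; rewrite derive1E; apply: derive_val.
  exact: (is_derive_mul _ _ y _ _ (dvar y) (td_is_derive_space y t y0 t0).1).
have -> : derive1n 2 (fun y => inf_variance mu y * h y t) x =
    derive1 (derive1 (fun y => inf_variance mu y * h y t)) x by [].
have d2 : is_derive x 1 (fun y => 2 * mu * h y t
    + inf_variance mu y * derive1 (h^~ t) y) _ :=
  is_derive_add _ _ x _ _ (is_derive_mull (2 * mu) _ x _ hx)
    (is_derive_mul _ _ x _ _ (dvar x) hxx).
(* [d1] is available only for [y > 0], so the second derivative is transferred through an equality
   valid near [x]. *)
have e : \forall y \near x, 2 * mu * h y t
    + inf_variance mu y * derive1 (h^~ t) y
    = derive1 (fun y => inf_variance mu y * h y t) y.
  by near=> y; apply/esym/d1; near: y; exact: lt_nbhsr.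
have d3 := near_eq_is_derive e d2.
have -> := etrans (derive1E _ x) (@derive_val _ _ _ _ _ _ _ d3).
by rewrite /inf_variance; field.
Unshelve. all: by end_near. Qed.

End transition_density.

(** * Conservation of the weighted Laplace transform along a characteristic *)

Section conservation.
Context {R : realType} (beta gamma mu : R) (h : R -> R -> R).
Hypothesis hh : transition_density_from0 beta gamma mu h.
Notation leb := (@lebesgue_measure R).
Notation pos := (`]0, +oo[ : set R).

(** [s] and [c] enter only through their differential equations and bounds. Taking [T < V] leaves
    room for two-sided derivatives at [T]. *)
Variables (V T S C : R) (s c : R -> R).
Hypothesis TV : T < V.
Hypothesis ds : forall t, 0 < t < V ->
  is_derive t 1 s (- beta * s t + mu * s t ^+ 2).
Hypothesis dc : forall t, 0 < t < V ->
  is_derive t 1 c (gamma * mu * s t * c t).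
Hypothesis sS : forall t, 0 < t <= T -> 0 <= s t <= S.
Hypothesis cC : forall t, 0 < t <= T -> 0 <= c t <= C.

(* [psi] vanishes at [x = 0], so that its product with a cutoff near [0] has a
   bounded image under the generator; and [psi_t + L psi = - c']. *)
Let psi (x t : R) := c t * (expR (- (s t * x)) - 1).
Let psi1 (x t : R) := - (c t * s t) * expR (- (s t * x)).
Let psi2 (x t : R) := c t * s t ^+ 2 * expR (- (s t * x)).
Let psit (x t : R) := gamma * mu * s t * c t * (expR (- (s t * x)) - 1)
  + c t * (expR (- (s t * x)) * - ((- beta * s t + mu * s t ^+ 2) * x)).

Let k0 (n : nat) (x : R) := cut0 (n.+1%:R^-1 / x) (x / n.+2%:R).
Let k1 (n : nat) (x : R) := cut1 (n.+1%:R^-1 / x) (x / n.+2%:R).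
Let k2 (n : nat) (x : R) := cut2 (n.+1%:R^-1 / x) (x / n.+2%:R).

Let th n x t := psi x t * k0 n x.
Let th1 n x t := psi1 x t * k0 n x + psi x t * (k1 n x / x).
Let th2 n x t := (psi2 x t * k0 n x + psi1 x t * (k1 n x / x))
  + (psi1 x t * (k1 n x / x) + psi x t * (k2 n x / x ^+ 2)).

(** What is left of [psi_t chi + L (psi chi)]: the first term is [- c' chi], and the others carry
    [x chi'] or [x^2 chi'']. The terms of [psit] and of [L psi] that contain a factor [x] have
    cancelled by the equation for [s]. *)
Let rest n x t := - (gamma * mu * s t * c t) * k0 n x
  + (beta * psi x t + gamma * mu * (psi x t / x) + 2 * mu * psi1 x t) * k1 n x
  + mu * (psi x t / x) * k2 n x.

Let restE n (x t : R) : 0 < x ->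
  psit x t * k0 n x + generator_at beta gamma mu x (th1 n x t) (th2 n x t)
  = rest n x t.
Proof.
move=> x0.
rewrite /rest /generator_at /drift /th1 /th2 /psit /psi /psi1 /psi2.
by have xn0 := lt0r_neq0 x0; field.
Qed.

Let is_derive_exp_space (x t : R) :
  is_derive x 1 (fun y => expR (- (s t * y))) (- s t * expR (- (s t * x))).
Proof.
have did : is_derive x 1 (fun y : R => y) 1 by exact: is_derive_id.
have d1 := is_derive_mull (- s t) _ x _ did.
have d2 := is_derive_chain expR _ x _ _ (is_derive_expR _) d1.
have -> : (fun y => expR (- (s t * y))) = (fun y => expR (- s t * y)).
  by apply/funext => y; rewrite mulNr.
by apply: is_derive_eq d2 _; rewrite !mulNr; ring.
Qed.

Let dpsi (x t : R) : is_derive x 1 (psi^~ t) (psi1 x t).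
Proof.
have d1 := is_derive_mull (c t) _ x _ (is_derive_sub _ _ x _ _
  (is_derive_exp_space x t) (is_derive_const 1 x)).
by apply: is_derive_eq d1 _; rewrite /psi1; ring.
Qed.

Let dpsi1 (x t : R) : is_derive x 1 (psi1^~ t) (psi2 x t).
Proof.
have d1 := is_derive_mull (- (c t * s t)) _ x _ (is_derive_exp_space x t).
by apply: is_derive_eq d1 _; rewrite /psi2; ring.
Qed.

Let dpsit (x t : R) : 0 < t < V -> is_derive t 1 (psi x) (psit x t).
Proof.
move=> tV.
have d1 := is_derive_mul _ _ t _ _ (ds t tV) (is_derive_const x t).
have d2 := is_derive_mull (-1) _ t _ d1.
have d3 := is_derive_chain expR _ t _ _ (is_derive_expR _) d2.
have d4 := is_derive_mul _ _ t _ _ (dc t tV)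
  (is_derive_sub _ _ t _ _ d3 (is_derive_const 1 t)).
have -> : psi x = (fun t => c t * (expR (-1 * (s t * x)) - 1)).
  by apply/funext => u; rewrite /psi mulN1r.
by apply: is_derive_eq d4 _; rewrite /psit mulN1r; ring.
Qed.

Let dk n (x : R) : 0 < x -> is_derive x 1 (k0 n) (k1 n x / x) /\
  is_derive x 1 (fun y => k1 n y / y) (k2 n x / x ^+ 2).
Proof. by move=> x0; apply: is_derive_cut. Qed.

Let dth n (x t : R) : 0 < x -> is_derive x 1 (th n ^~ t) (th1 n x t).
Proof. by move=> x0; exact: (is_derive_mul _ _ x _ _ (dpsi x t) (dk n x x0).1). Qed.

Let dth1 n (x t : R) : 0 < x -> is_derive x 1 (th1 n ^~ t) (th2 n x t).
Proof.
move=> x0; have [d0 d1] := dk n x x0.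
exact: (is_derive_add _ _ x _ _ (is_derive_mul _ _ x _ _ (dpsi1 x t) d0)
  (is_derive_mul _ _ x _ _ (dpsi x t) d1)).
Qed.

Let ck0 n (x : R) : 0 < x -> {for x, continuous (k0 n)}.
Proof. by move=> /(dk n)[]; move=> d _; exact: is_derive_continuous d. Qed.

Let ck1x n (x : R) : 0 < x -> {for x, continuous (fun y => k1 n y / y)}.
Proof. by move=> /(dk n)[] _ d; exact: is_derive_continuous d. Qed.

Let cV (x : R) : 0 < x -> {for x, continuous (fun y : R => y^-1)}.
Proof.
by move=> x0; exact: (is_derive_continuous _ _ _ (is_derive_inv x (lt0r_neq0 x0))).
Qed.

Let ck1 n (x : R) : 0 < x -> {for x, continuous (k1 n)}.
Proof.
move=> x0; have c1 : {for x, continuous (fun y => k1 n y / y * y)}.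
  by apply: cvgM; [exact: ck1x|exact: cvg_id].
have e : \forall y \near x, k1 n y / y * y = k1 n y.
  near=> y; rewrite divfK//; apply: lt0r_neq0.
  by near: y; exact: lt_nbhsr.
rewrite /prop_for /continuous_at -(nbhs_singleton e).
by apply: cvg_trans c1; exact: near_eq_cvg.
Unshelve. all: by end_near. Qed.

Let ck2 n (x : R) : 0 < x -> {for x, continuous (k2 n)}.
Proof.
move=> x0.
have c0 (k : R) : {for x, continuous (fun _ : R => k)} by exact: cvg_cst.
have cp : {for x, continuous (fun y : R => n.+1%:R^-1 / y)}.
  by apply: cvgM; [exact: c0|exact: cV].
have cq : {for x, continuous (fun y : R => y / n.+2%:R)}.
  by apply: cvgM; [exact: cvg_id|exact: c0].
have c1p : {for x, continuous (fun y : R => 1 - n.+1%:R^-1 / y)}.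
  by apply: cvgB; [exact: c0|].
have c1q : {for x, continuous (fun y : R => 1 - y / n.+2%:R)}.
  by apply: cvgB; [exact: c0|].
have sq (u : R -> R) : {for x, continuous u} ->
  {for x, continuous (fun y => u y ^+ 2)} by move=> cu; exact: (cvgM cu cu).
rewrite /k2 /cut2; apply: cvgD; [apply: cvgB|].
- apply: cvgM; last exact: sq.
  by apply: cvgB; apply: cvgM; [exact: c0|exact: sq|exact: c0|].
- apply: cvgM; last exact: cvgM.
  by apply: cvgM; [exact: c0|exact: cvgM].
- apply: cvgM; last exact: sq.
  by apply: cvgM; [exact: c0|exact: sq].
Qed.

Let cpsi (x t : R) : {for x, continuous (psi^~ t)}.
Proof. exact: is_derive_continuous (dpsi x t). Qed.

Let cpsi1 (x t : R) : {for x, continuous (psi1^~ t)}.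
Proof. exact: is_derive_continuous (dpsi1 x t). Qed.

Let crest n (x t : R) : 0 < x -> {for x, continuous (rest n ^~ t)}.
Proof.
move=> x0.
have cpx : {for x, continuous (fun y => psi y t / y)}.
  by apply: cvgM; [exact: cpsi|exact: cV].
apply: cvgD; [apply: cvgD|].
- by apply: cvgMl_tmp; exact: ck0.
- apply: cvgM; last exact: ck1.
  apply: cvgD; last by apply: cvgMl_tmp; exact: cpsi1.
  by apply: cvgD; apply: cvgMl_tmp; [exact: cpsi|].
- by apply: cvgM; [exact: cvgMl_tmp|exact: ck2].
Qed.

Let cth2 n (x t : R) : 0 < x -> {for x, continuous (th2 n ^~ t)}.
Proof.
move=> x0.
have cp2 : {for x, continuous (psi2^~ t)}.
  apply: cvgMl_tmp; exact: is_derive_continuous (is_derive_exp_space x t).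
apply: cvgD; apply: cvgD; apply: cvgM.
- exact: cp2.
- exact: ck0.
- exact: cpsi1.
- exact: ck1x.
- exact: cpsi1.
- exact: ck1x.
- exact: cpsi.
- apply: cvgM; first exact: ck2.
  rewrite /prop_for /continuous_at -exprVn; under eq_fun do rewrite -exprVn.
  exact: (cvgM (cV x x0) (cV x x0)).
Qed.

(** The squares in [cut0] give a double zero at [p = 1] and at [q = 1], which are the two ends of
    [exhaust n]; this removes all boundary terms of the integration by parts. *)
Let th_ends n t : [/\ th n n.+1%:R^-1 t = 0, th1 n n.+1%:R^-1 t = 0,
  th n n.+2%:R t = 0 & th1 n n.+2%:R t = 0].
Proof.
have e1 : n.+1%:R^-1 / n.+1%:R^-1 = 1 :> R by rewrite divff ?invr_eq0.
have e2 : n.+2%:R / n.+2%:R = 1 :> R by rewrite divff.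
rewrite /th /th1 /k0 /k1 e1 e2 /cut0 /cut1 !subrr.
by split; rewrite expr0n/=; ring.
Qed.

Let ratios_bounds n (x : R) : exhaust n x ->
  0 <= n.+1%:R^-1 / x <= 1 /\ 0 <= x / n.+2%:R <= 1.
Proof.
move=> nx; have x0 := exhaust_pos n x nx; move: nx.
rewrite /exhaust/= in_itv/= => /andP[ax xb]; split.
  by rewrite divr_ge0 ?invr_ge0 ?(ltW x0)//= ler_pdivrMr// mul1r.
by rewrite divr_ge0 ?(ltW x0)//= ler_pdivrMr// mul1r.
Qed.

(** Follows [rest] term by term, with 4 and 20 from [cut_bounds]; it depends on neither [n], [x] nor
    [t]. *)
Let Kbound := (`|gamma * mu| * S * C
  + (`|beta| * C + `|gamma * mu| * (C * S) + 2 * `|mu| * (C * S)) * 4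
  + `|mu| * (C * S) * 20).

(** From [0 <= 1 - e^(-y) <= min(1, y)] for [y = s t * x >= 0]; the second half gives the bound on
    [psi / x]. *)
Let psi_bounds (x t : R) : 0 < x -> 0 < t <= T ->
  [/\ `|psi x t| <= C, `|psi x t / x| <= C * S & `|psi1 x t| <= C * S].
Proof.
move=> x0 tT; have /andP[s0 s1] := sS t tT; have /andP[c0 c1] := cC t tT.
have C0 : 0 <= C by exact: le_trans c1.
have S0 : 0 <= S by exact: le_trans s1.
have e0 : 0 <= expR (- (s t * x)) by exact: expR_ge0.
have sx0 : 0 <= s t * x by rewrite mulr_ge0// ltW.
have e1 : expR (- (s t * x)) <= 1 by rewrite -expR0 ler_expR oppr_le0.
have e2 : 1 - s t * x <= expR (- (s t * x)) by exact: expR_ge1Dx.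
have ne : `|expR (- (s t * x)) - 1| <= 1 by rewrite ler_norml; lra.
have nex : `|expR (- (s t * x)) - 1| <= s t * x by rewrite ler_norml; lra.
split.
- by rewrite /psi normrM (ger0_norm c0) -[leRHS]mulr1 ler_pM.
- rewrite /psi normrM normrM (ger0_norm c0) normfV (gtr0_norm x0) -mulrA.
  rewrite ler_pM//; first by rewrite divr_ge0// ltW.
  by rewrite ler_pdivrMr// (le_trans nex)// ler_wpM2r// ltW.
- have cs0 : 0 <= c t * s t by rewrite mulr_ge0.
  rewrite /psi1 normrM normrN (ger0_norm cs0) (ger0_norm e0).
  by rewrite -[leRHS]mulr1 ler_pM// ler_pM.
Qed.

Let Kbound_ge0 (t : R) : 0 < t <= T -> 0 <= Kbound.
Proof.
move=> tT; have /andP[s0 s1] := sS t tT; have /andP[c0 c1] := cC t tT.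
have C0 : 0 <= C by exact: le_trans c1.
have S0 : 0 <= S by exact: le_trans s1.
by rewrite /Kbound !(addr_ge0, mulr_ge0).
Qed.

Let rest_bound n (x t : R) : 0 < t <= T -> exhaust n x ->
  `|rest n x t| <= Kbound.
Proof.
move=> tT nx; have x0 := exhaust_pos n x nx.
have /andP[s0 s1] := sS t tT; have /andP[c0 c1] := cC t tT.
have C0 : 0 <= C by exact: le_trans c1.
have S0 : 0 <= S by exact: le_trans s1.
have [pb qb] := ratios_bounds n x nx.
have [b0 b1 b2] := cut_bounds _ _ pb qb.
have [p0 px p1] := psi_bounds x t x0 tT.
rewrite /rest /Kbound.
apply: (le_trans (ler_normD _ _)); apply: lerD.
  apply: (le_trans (ler_normD _ _)); apply: lerD.
    rewrite normrM normrN -[leRHS]mulr1 ler_pM// normrM (ger0_norm c0).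
    rewrite ler_pM// normrM (ger0_norm s0).
    by rewrite ler_wpM2l.
  rewrite normrM ler_pM//.
  apply: (le_trans (ler_normD _ _)); apply: lerD.
    apply: (le_trans (ler_normD _ _)); apply: lerD.
      by rewrite normrM ler_wpM2l.
    by rewrite normrM ler_wpM2l.
  by rewrite normrM normrM (ger0_norm (ler0n _ 2)) ler_wpM2l ?mulr_ge0.
by rewrite normrM ler_pM// normrM ler_wpM2l.
Qed.

Let ratios_cvg (x : R) : 0 < x ->
  n.+1%:R^-1 / x @[n --> \oo] --> (0 : R) /\
  x / n.+2%:R @[n --> \oo] --> (0 : R).
Proof.
move=> x0.
have inv0 : (n.+1%:R^-1 : R) @[n --> \oo] --> (0 : R) by exact: cvg_harmonic.
split.
  by rewrite -[X in _ --> X](mul0r x^-1); exact: cvgMr_tmp.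
rewrite -[X in _ --> X](mulr0 x); apply: cvgMl_tmp.
by move: inv0; rewrite -(cvg_shiftS (fun n => n.+1%:R^-1 : R)).
Qed.

Let k0_cvg (x : R) : 0 < x -> k0 n x @[n --> \oo] --> (1 : R).
Proof. by move=> /ratios_cvg[cp cq]; have [] := cut_cvg _ _ cp cq. Qed.

Let rest_cvg (x t : R) : 0 < x ->
  rest n x t @[n --> \oo] --> - (gamma * mu * s t * c t).
Proof.
move=> /ratios_cvg[cp cq]; have [cv0 cv1 cv2] := cut_cvg _ _ cp cq.
set A := beta * psi x t + gamma * mu * (psi x t / x) + 2 * mu * psi1 x t.
have -> : - (gamma * mu * s t * c t) = - (gamma * mu * s t * c t) * 1 + A * 0
    + mu * (psi x t / x) * 0 by rewrite mulr1 !mulr0 !addr0.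
by apply: cvgD; [apply: cvgD|]; exact: cvgMl_tmp.
Qed.

Let F n x t := th n x t * h x t.
Let F' n x t := psit x t * k0 n x * h x t + th n x t * derive1 (h x) t.
Let M n t := \int[leb]_(x in exhaust n) F n x t.
Let M' n t := \int[leb]_(x in exhaust n) F' n x t.

Let tV_pos (t : R) : 0 < t < V -> 0 < t.
Proof. by case/andP. Qed.

Let strip_F n : continuous_strip V (F n) /\ continuous_strip V (F' n).
Proof.
have cs : continuous_strip V (fun _ t => s t).
  by apply: continuous_strip_of_time => t /ds; exact: is_derive_continuous.
have cc : continuous_strip V (fun _ t => c t).
  by apply: continuous_strip_of_time => t /dc; exact: is_derive_continuous.
have cx : continuous_strip V (fun x _ => x).
  by apply: (continuous_strip_of_space V id) => x _; exact: cvg_id.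
have ck (k : R) : continuous_strip V (fun _ _ => k).
  by move=> x t _ _; exact: cvg_cst.
have cN (f : R -> R -> R) : continuous_strip V f ->
    continuous_strip V (fun x t => - f x t).
  by move=> cf x t x0 tV; apply: cvgN; exact: cf.
have cE : continuous_strip V (fun x t => expR (- (s t * x))).
  by apply: continuous_strip_exp; apply: cN; exact: continuous_strip_mul.
have cE1 : continuous_strip V (fun x t => expR (- (s t * x)) - 1).
  exact: (continuous_strip_add V _ _ cE (ck (-1))).
have cp : continuous_strip V psi by exact: continuous_strip_mul.
have cs' : continuous_strip V (fun _ t => - beta * s t + mu * s t ^+ 2).
  apply: continuous_strip_add; first exact: (continuous_strip_mul V _ _ (ck (- beta)) cs).
  apply: (continuous_strip_mul V _ _ (ck mu)).
  exact: (continuous_strip_mul V _ _ cs cs).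
have cpt : continuous_strip V psit.
  apply: continuous_strip_add.
    apply: continuous_strip_mul cE1.
    apply: continuous_strip_mul cc.
    exact: (continuous_strip_mul V _ _ (ck (gamma * mu)) cs).
  apply: (continuous_strip_mul V _ _ cc).
  apply: (continuous_strip_mul V _ _ cE); apply: cN.
  exact: (continuous_strip_mul V _ _ cs' cx).
have ck0s : continuous_strip V (fun x _ => k0 n x).
  by apply: continuous_strip_of_space => x; exact: ck0.
have cth : continuous_strip V (th n) by exact: continuous_strip_mul.
have [_ ch cht _ _] := td_regular hh.
have chs : continuous_strip V h by move=> x t x0 /tV_pos; exact: ch.
have chts : continuous_strip V (fun x t => derive1 (h x) t).
  by move=> x t x0 /tV_pos; exact: cht.
split; first exact: continuous_strip_mul.
apply: continuous_strip_add; last exact: continuous_strip_mul.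
by apply: continuous_strip_mul chs; exact: continuous_strip_mul.
Qed.

Let dM n (t : R) : 0 < t < V ->
  is_derive t 1 (M n) (M' n t) /\ {for t, continuous (M' n)}.
Proof.
move=> tV; have [cF cF'] := strip_F n.
apply: (is_derive_integral_strip V (F n) (F' n)) => // x u x0 uV.
have := is_derive_mul _ _ u _ _
  (is_derive_mul _ _ u _ _ (dpsit x u uV) (is_derive_const (k0 n x) u))
  (td_is_derive_time beta gamma mu h hh x u x0 (tV_pos u uV)).
by move=> d; apply: is_derive_eq d _; rewrite /F' /th; ring.
Qed.

(** The adjoint identity trades [th] times the time derivative of [h] for the generator of [th]
    times [h]. No derivative of [h] remains, and the uniform bound on [rest] becomes applicable. *)
Let M'E n (t : R) : 0 < t < V ->
  M' n t = \int[leb]_(x in exhaust n) (rest n x t * h x t).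
Proof.
move=> tV; have t0 := tV_pos t tV.
have a0 : 0 < n.+1%:R^-1 :> R by rewrite invr_gt0.
have ab : n.+1%:R^-1 < n.+2%:R :> R.
  rewrite (@le_lt_trans _ _ 1) ?ltr1n//.
  by rewrite invf_le1// ler1n.
have [e1 e2 e3 e4] := th_ends n t.
have adj := integral_adjoint beta gamma mu _ _ _ _ _ _ _ _ _ a0 ab
  (fun x x0 => (td_is_derive_space beta gamma mu h hh x t x0 t0).1)
  (fun x x0 => (td_is_derive_space beta gamma mu h hh x t x0 t0).2)
  _ (fun x x0 => dth n x t x0) (fun x x0 => dth1 n x t x0)
  (fun x x0 => cth2 n x t x0)
  (fun x x0 => td_fokker_planck_expanded beta gamma mu h hh x t x0 t0)
  e1 e2 e3 e4.
have [_ cF'] := strip_F n.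
apply/eqP; rewrite -subr_eq0 -RintegralB//; first last.
- apply: pos_continuous_integrable => // x x0.
  apply: cvgM; first exact: crest.
  exact: (td_continuous_space beta gamma mu h hh).
- apply: pos_continuous_integrable => // x x0.
  exact: (continuous_strip_space V).
- exact: measurable_itv.
apply/eqP; rewrite -[RHS]adj; last first.
  move=> x x0; have [_ _ _ _ chxx] := td_regular hh.
  have cs : continuous_strip V (fun x t => derive1n 2 (h^~ t) x).
    by move=> y u y0 /tV_pos; exact: chxx.
  exact: (continuous_strip_space V _ _ _ cs).
apply: eq_Rintegral => x /set_mem nx.
have x0 := exhaust_pos n x nx.
by rewrite -restE// /F'; ring.
Qed.

Let E t := \int[leb]_(x in pos) (psi x t * h x t).

Let tT_V (t : R) : 0 < t <= T -> 0 < t < V.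
Proof. by move=> /andP[-> tT]/=; exact: le_lt_trans TV. Qed.

Let M_cvg (t : R) : 0 < t <= T -> M n t @[n --> \oo] --> E t.
Proof.
move=> tT; have /andP[t0 _] := tT.
have C0 : 0 <= C by have /andP[c0 c1] := cC t tT; exact: le_trans c1.
apply: (Rintegral_exhaust_cvg (fun n x => th n x t) (psi^~ t) (h^~ t) C C0).
- exact: (td_integrable beta gamma mu h hh).
- by move=> n x x0; exact: is_derive_continuous (dth n x t x0).
- move=> n x nx; have [pb qb] := ratios_bounds n x nx.
  have [b0 _ _] := cut_bounds _ _ pb qb.
  have [p0 _ _] := psi_bounds x t (exhaust_pos n x nx) tT.
  by rewrite normrM -[leRHS]mulr1 ler_pM.
- move=> x x0; rewrite -[X in _ --> X]mulr1; apply: cvgMl_tmp.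
  exact: k0_cvg.
Qed.

Let M'_cvg (t : R) : 0 < t <= T ->
  M' n t @[n --> \oo] --> - (gamma * mu * s t * c t).
Proof.
move=> tT; have /andP[t0 _] := tT.
under eq_fun do rewrite (M'E _ _ (tT_V t tT)).
have -> : - (gamma * mu * s t * c t) =
    \int[leb]_(x in pos) (- (gamma * mu * s t * c t) * h x t).
  rewrite RintegralZl//; last exact: (td_integrable beta gamma mu h hh).
  by rewrite (td_mass beta gamma mu h hh)// mulr1.
apply: (Rintegral_exhaust_cvg (fun n x => rest n x t)
  (cst (- (gamma * mu * s t * c t))) (h^~ t) Kbound (Kbound_ge0 t tT)).
- exact: (td_integrable beta gamma mu h hh).
- by move=> n x; exact: crest.
- by move=> n x; exact: rest_bound.
- by move=> x; exact: rest_cvg.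
Qed.

Let M'_bound n (t : R) : 0 < t <= T -> `|M' n t| <= Kbound.
Proof.
move=> tT; have /andP[t0 _] := tT; rewrite (M'E _ _ (tT_V t tT)).
have := norm_Rintegral_exhaust_le n (rest n ^~ t) (h^~ t) Kbound
  (Kbound_ge0 t tT) (td_integrable beta gamma mu h hh t t0)
  (fun x => crest n x t) (fun x => rest_bound n x t tT).
rewrite (@eq_Rintegral _ _ _ leb pos (h^~ t)); last first.
  move=> x /set_mem/=; rewrite in_itv/= andbT => x0.
  by rewrite ger0_norm// (td_ge0 beta gamma mu h hh).
by rewrite (td_mass beta gamma mu h hh)// mulr1.
Qed.

(** [M n T - M n t1] has two limits in [n]: directly, and as the time integral of [M' n], which is
    dominated by [Kbound] and converges pointwise to [- c']. *)
Let E_balance (t1 : R) : 0 < t1 < T -> E T - E t1 = - (c T - c t1).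
Proof.
move=> /andP[t10 t1T].
have inT t : t1 <= t <= T -> 0 < t <= T.
  by move=> /andP[t1t ->]; rewrite (lt_le_trans t10).
have TT : 0 < T <= T by rewrite lexx (lt_trans t10).
have t1t : 0 < t1 <= T by rewrite t10 ltW.
have memT t : `[t1, T]%classic t -> 0 < t <= T.
  by rewrite /= in_itv/=; exact: inT.
have ftc n : \int[leb]_(t in `[t1, T]) M' n t = M n T - M n t1.
  rewrite /Rintegral (integral_is_derive (M' n) (M n) t1 T t1T
    (fun t tT => (dM n t (tT_V t (inT t tT))).1)
    (fun t tT => (dM n t (tT_V t (inT t tT))).2)) //.
have ftcc : \int[leb]_(t in `[t1, T]) - (gamma * mu * s t * c t)
    = - (c T - c t1).
  have dcN (t : R) : t1 <= t <= T ->
      is_derive t 1 (fun t => -1 * c t) (- (gamma * mu * s t * c t)).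
    move=> /inT /tT_V tV.
    by apply: is_derive_eq (is_derive_mull (-1) _ t _ (dc t tV)) _; rewrite mulN1r.
  have cN (t : R) : t1 <= t <= T ->
      {for t, continuous (fun t => - (gamma * mu * s t * c t))}.
    move=> /inT /tT_V tV; apply: cvgN; apply: cvgM.
      by apply: cvgMl_tmp; exact: is_derive_continuous (ds t tV).
    exact: is_derive_continuous (dc t tV).
  rewrite /Rintegral (integral_is_derive _ _ t1 T t1T dcN cN) /=.
  by rewrite !mulN1r opprB opprK addrC.
have cv1 : M n T - M n t1 @[n --> \oo] --> E T - E t1.
  by apply: cvgB; exact: M_cvg.
have cv2 : M n T - M n t1 @[n --> \oo] --> - (c T - c t1).
  under eq_fun do rewrite -ftc.
  rewrite -ftcc.
  apply: (Rintegral_dominated_cvg leb _ M' _ (cst Kbound)).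
  - exact: measurable_itv.
  - move=> n; apply: subspace_continuous_measurable_fun.
      exact: measurable_itv.
    apply: continuous_in_subspaceT => t /set_mem/memT/tT_V tV.
    exact: (dM n t tV).2.
  - by move=> t /memT; exact: M'_cvg.
  - apply: continuous_compact_integrable; first exact: segment_compact.
    by apply: continuous_subspaceT => x; exact: cvg_cst.
  - by move=> n t /memT; exact: M'_bound.
by apply: (cvg_unique _ cv1 cv2).
Qed.

Lemma weighted_laplace_conserved (t1 : R) : 0 < t1 < T ->
  c T * \int[leb]_(x in pos) (expR (- (s T * x)) * h x T) =
  c t1 * \int[leb]_(x in pos) (expR (- (s t1 * x)) * h x t1).
Proof.
move=> t1T; have /andP[t10 t1_T] := t1T.
have TT : 0 < T <= T by rewrite lexx (lt_trans t10).
have t1t : 0 < t1 <= T by rewrite t10 ltW.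
(* By unit mass the [- 1] in [psi] contributes [- c t], which cancels against the right-hand side of
   [E_balance]. *)
have EE t : 0 < t <= T -> E t =
    c t * \int[leb]_(x in pos) (expR (- (s t * x)) * h x t) - c t.
  move=> tT; have /andP[t0 _] := tT; have /andP[s0 _] := sS t tT.
  have hi := td_integrable beta gamma mu h hh t t0.
  have mpos : measurable pos by exact: measurable_itv.
  have ei := integrable_laplace (h^~ t) (s t) s0 hi.
  have cei : leb.-integrable pos
      (EFin \o (fun x => c t * (expR (- (s t * x)) * h x t))).
    exact: (integrable_EFin_mull leb pos).
  have ch : leb.-integrable pos (EFin \o (fun x => c t * h x t)).
    exact: (integrable_EFin_mull leb pos).
  transitivity (\int[leb]_(x in pos)
      (c t * (expR (- (s t * x)) * h x t) - c t * h x t)).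
    by apply: eq_Rintegral => x _; rewrite /psi; ring.
  rewrite RintegralB// !RintegralZl//.
  by rewrite (td_mass beta gamma mu h hh)// mulr1.
have := E_balance t1 t1T; rewrite !EE//; lra.
Qed.

End conservation.

(** * The Laplace transform at time [T] and the resulting gamma density *)

Section laplace_transform.
Context {R : realType} (beta gamma mu : R) (h : R -> R -> R).
Hypothesis gamma_gt0 : 0 < gamma.
Hypothesis mu_gt0 : 0 < mu.
Hypothesis beta_lt0 : beta < 0.
Hypothesis hh : transition_density_from0 beta gamma mu h.
Notation leb := (@lebesgue_measure R).
Notation pos := (`]0, +oo[ : set R).

Let phi (sigma t : R) := \int[leb]_(x in pos) (expR (- (sigma * x)) * h x t).

Let phi_integrable (sigma t : R) : 0 <= sigma -> 0 < t ->
  leb.-integrable pos (EFin \o (fun x => expR (- (sigma * x)) * h x t)).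
Proof.
by move=> s0 t0; apply: integrable_laplace => //; exact: (td_integrable beta gamma mu h hh).
Qed.

Let phi_anti (s1 s2 t : R) : 0 <= s1 <= s2 -> 0 < t -> phi s2 t <= phi s1 t.
Proof.
move=> /andP[s10 s12] t0; apply: le_Rintegral => //.
- by apply: phi_integrable => //; exact: le_trans s12.
- exact: phi_integrable.
move=> x; rewrite /= in_itv/= andbT => x0.
rewrite ler_wpM2r ?(td_ge0 beta gamma mu h hh)//.
by rewrite ler_expR lerN2 ler_wpM2r// ltW.
Qed.

Let phi0 (t : R) : 0 < t -> phi 0 t = 1.
Proof.
move=> t0; rewrite -(td_mass beta gamma mu h hh t t0).
by apply: eq_Rintegral => x _; rewrite mul0r oppr0 expR0 mul1r.
Qed.

Let phi_initial (sigma : R) : 0 <= sigma -> phi sigma t @[t --> 0^'+] --> (1 : R).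
Proof.
(* The absolute value makes the exponential bounded on the whole line, as a test function must
   be. *)
move=> s0; pose f (x : R) := expR (- (sigma * `|x|)).
have cf : continuous f.
  move=> x; apply: (@continuous_comp _ _ _ (fun x => - (sigma * `|x|)) expR).
    by apply: cvgN; apply: cvgMl_tmp; exact: norm_continuous.
  exact: continuous_expR.
have bf : exists M : R, forall x, `|f x| <= M.
  exists 1 => x; rewrite ger0_norm ?expR_ge0// -expR0 ler_expR oppr_le0.
  by rewrite mulr_ge0.
have := td_initial hh cf bf.
have -> : f 0 = 1 by rewrite /f normr0 mulr0 oppr0 expR0.
apply: cvg_trans; apply: near_eq_cvg; apply: nearW => t.
apply: eq_Rintegral => x /set_mem/=; rewrite in_itv/= andbT => x0.
by rewrite /f gtr0_norm.
Qed.

(* Along the characteristic [s' = - beta s + mu s^2] ending at [s T = sigma],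
   the weight [c = k^(- gamma)] solves [c' = gamma mu s c]. *)
Lemma td_laplace (sigma T : R) : 0 < sigma -> 0 < T ->
  phi sigma T =
  (1 + sigma * (mu * (1 - expR (beta * T)) / - beta)) `^ (- gamma).
Proof.
move=> sig0 T0; pose b := - beta.
have b0 : 0 < b by rewrite oppr_gt0.
have bN : beta = - b by rewrite /b opprK.
have bn0 := lt0r_neq0 b0; have mun0 := lt0r_neq0 mu_gt0.
(* The substitution [s = - k' / (mu k)] linearises the Riccati equation to [k'' = b k']. The
   constants [P] and [Q] are fixed by [k T = 1] and [s T = sigma]. *)
pose P := 1 + sigma * mu / b; pose Q := sigma * mu / b * expR (- (b * T)).
pose k t := P - Q * expR (b * t).
have p0 : 0 < sigma * mu / b by rewrite divr_gt0// mulr_gt0.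
have Q0 : 0 < Q by rewrite mulr_gt0// expR_gt0.
have P0 : 0 < P by rewrite addr_gt0.
have QT : Q * expR (b * T) = sigma * mu / b.
  by rewrite /Q -mulrA -expRD addNr expR0 mulr1.
have kT : k T = 1 by rewrite /k QT /P addrK.
(* [V] is the zero of [k], where [s] blows up; it lies beyond [T] because [P > sigma mu / b]. *)
pose V := T + ln (P / (sigma * mu / b)) / b.
have TV : T < V.
  rewrite /V ltrDl divr_gt0// ln_gt0// ltr_pdivlMr// mul1r /P.
  by rewrite ltrDr.
have QV : Q * expR (b * V) = P.
  have -> : b * V = b * T + ln (P / (sigma * mu / b)).
    by rewrite /V mulrDr [b * (_ / b)]mulrC divfK.
  rewrite expRD mulrA QT lnK ?posrE; last exact: divr_gt0.
  by rewrite mulrC divfK// lt0r_neq0.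
have k_gt0 t : t < V -> 0 < k t.
  by move=> tV; rewrite /k subr_gt0 -QV ltr_pM2l// ltr_expR ltr_pM2l.
have k_ge1 t : t <= T -> 1 <= k t.
  by move=> tT; rewrite -kT /k lerB// ler_pM2l// ler_expR ler_pM2l.
pose s t := b / mu * (Q * expR (b * t)) / k t.
pose c t := k t `^ (- gamma).
have dE (t : R) : is_derive t 1 (fun t => Q * expR (b * t)) (Q * expR (b * t) * b).
  have did : is_derive t 1 (fun y : R => y) 1 by exact: is_derive_id.
  have d1 := is_derive_mull b _ t _ did.
  have d2 := is_derive_mull Q _ t _
    (is_derive_chain expR _ t _ _ (is_derive_expR _) d1).
  by apply: is_derive_eq d2 _; rewrite mulr1 mulrA.
have dk (t : R) : is_derive t 1 k (- (Q * expR (b * t) * b)).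
  by apply: is_derive_eq (is_derive_sub _ _ t _ _ (is_derive_const P t) (dE t)) _;
    rewrite sub0r.
have ds t : 0 < t < V -> is_derive t 1 s (- beta * s t + mu * s t ^+ 2).
  move=> /andP[_ tV]; have kn0 := lt0r_neq0 (k_gt0 t tV).
  have dkV := is_derive_chain (fun y => y^-1) k t _ _ (is_derive_inv _ kn0) (dk t).
  have d := is_derive_mul _ _ t _ _ (is_derive_mull (b / mu) _ t _ (dE t)) dkV.
  apply: is_derive_eq d _; rewrite /s -/b.
  by field; rewrite ?kn0 ?mun0.
have dc t : 0 < t < V -> is_derive t 1 c (gamma * mu * s t * c t).
  move=> /andP[_ tV]; have kt0 := k_gt0 t tV; have kn0 := lt0r_neq0 kt0.
  have d := is_derive_chain (fun z => z `^ (- gamma)) k t _ _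
    (is_derive1_powR (- gamma) kt0) (dk t).
  apply: is_derive_eq d _; rewrite /s /c.
  rewrite powRB ?(negbTE kn0) ?implybT// powRr1 ?ltW//.
  by field; rewrite ?kn0 ?mun0.
have sS t : 0 < t <= T -> 0 <= s t <= sigma.
  move=> /andP[_ tT]; have k1 := k_ge1 t tT.
  have k0 : 0 < k t by exact: lt_le_trans k1.
  have e0 : 0 <= b / mu * (Q * expR (b * t)).
    by rewrite !mulr_ge0 ?expR_ge0 ?invr_ge0 ?ltW.
  rewrite /s divr_ge0 ?(ltW k0)//= ler_pdivrMr//.
  apply: (@le_trans _ _ sigma); last by rewrite ler_peMr// ltW.
  have -> : sigma = b / mu * (Q * expR (b * T)).
    by rewrite QT; field; rewrite ?bn0 ?mun0.
  rewrite ler_wpM2l ?divr_ge0 ?(ltW b0) ?(ltW mu_gt0)//.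
  by rewrite ler_pM2l// ler_expR ler_pM2l.
have cC t : 0 < t <= T -> 0 <= c t <= 1.
  move=> /andP[_ tT]; rewrite powR_ge0/= -(powRr0 (k t)).
  by rewrite ler_powR ?k_ge1// oppr_le0 ltW.
have sT : s T = sigma.
  by rewrite /s kT QT; field; rewrite ?bn0 ?mun0.
have cT : c T = 1 by rewrite /c kT powR1.
have cons t : 0 < t < T -> phi sigma T = c t * phi (s t) t.
  move=> tT; have := weighted_laplace_conserved beta gamma mu h hh V T sigma 1
    s c TV ds dc sS cC t tT.
  by rewrite cT sT mul1r.
have ccv : c t @[t --> 0^'+] --> c 0.
  apply: cvg_at_right_filter.
  have k0 : 0 < k 0 by apply: k_gt0; exact: lt_trans TV.
  have d := is_derive_chain (fun z => z `^ (- gamma)) k 0 _ _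
    (is_derive1_powR (- gamma) k0) (dk 0).
  exact: is_derive_continuous d.
have cE : c 0 = (1 + sigma * (mu * (1 - expR (beta * T)) / - beta)) `^ (- gamma).
  rewrite /c; congr (_ `^ _); rewrite /k mulr0 expR0 mulr1 /P /Q -/b.
  have -> : beta * T = - (b * T) by rewrite /b mulNr opprK.
  by field; rewrite ?bn0.
rewrite -cE.
(* Since [0 <= s t <= sigma] and [phi] decreases in its exponent, the conserved value lies between
   [c t * phi sigma t] and [c t * phi 0 t = c t]. Both tend to [c 0], and only the fixed exponent
   [sigma] meets the initial condition. *)
have lowc : c t * phi sigma t @[t --> 0^'+] --> c 0.
  rewrite -[X in _ --> X]mulr1; apply: cvgM => //.
  by apply: phi_initial; exact: ltW.
have near_lt : \forall t \near 0^'+, 0 < t < T.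
  near=> t; apply/andP; split.
    by near: t; exact: nbhs_right_gt.
  by near: t; exact: nbhs_right_lt.
apply/eqP; rewrite eq_le; apply/andP; split.
  apply: (cvgr_to_ge ccv); apply: filterS near_lt => t tT.
  have /andP[t0 tT'] := tT.
  have tle : 0 < t <= T by rewrite t0 ltW.
  have /andP[s0 _] := sS t tle; have /andP[c0 _] := cC t tle.
  rewrite (cons t tT) -[leRHS]mulr1 ler_wpM2l// -(phi0 t t0).
  by apply: phi_anti; rewrite ?lexx.
apply: (cvgr_to_le lowc); apply: filterS near_lt => t tT.
have /andP[t0 tT'] := tT.
have tle : 0 < t <= T by rewrite t0 ltW.
have /andP[c0 _] := cC t tle.
rewrite (cons t tT) ler_wpM2l//.
by apply: phi_anti => //; exact: sS.
Unshelve. all: by end_near. Qed.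

Definition gamma_rate (t : R) : R := - beta / (mu * (1 - expR (beta * t))).

Lemma gamma_rate_gt0 (t : R) : 0 < t -> 0 < gamma_rate t.
Proof.
move=> t0; rewrite /gamma_rate divr_gt0 ?oppr_gt0// mulr_gt0// subr_gt0.
by rewrite -expR0 ltr_expR nmulr_rlt0.
Qed.

(** Both sides are continuous and have the same Laplace transform at every integer. The factor
    [Gamma gamma] is kept on the left, so that it need not be known to be nonzero at this point. *)
Lemma td_gamma_density (x T : R) : 0 < x -> 0 < T ->
  Gamma gamma * h x T = gamma_rate T `^ gamma * (x `^ (gamma - 1)
    * expR (- (gamma_rate T * x))).
Proof.
move=> x0 T0; set r := gamma_rate T.
have r0 : 0 < r by exact: gamma_rate_gt0.
pose g (l x : R) := x `^ (gamma - 1) * expR (- (l * x)).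
have gl l : 0 < l -> leb.-integrable pos (EFin \o g l) /\
    \int[leb]_(x in pos) g l x = Gamma gamma * l `^ (- gamma).
  exact: gamma_laplace.
have hi := td_integrable beta gamma mu h hh T T0.
pose A x := Gamma gamma * h x T; pose B x := r `^ gamma * g r x.
have Ai : leb.-integrable pos (EFin \o A).
  exact: (integrable_EFin_mull leb pos).
have Bi : leb.-integrable pos (EFin \o B).
  by apply: (integrable_EFin_mull leb pos) => //; exact: (gl r r0).1.
have rn0 (n : nat) : 0 < r + n%:R by rewrite ltr_pwDl.
have laplaceA (n : nat) :
    \int[leb]_(x in pos) (expR (- (n%:R * x)) * A x) =
    Gamma gamma * (1 + n%:R / r) `^ (- gamma).
  transitivity (\int[leb]_(x in pos)
      (Gamma gamma * (expR (- (n%:R * x)) * h x T))).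
    by apply: eq_Rintegral => y _; rewrite /A mulrCA.
  rewrite RintegralZl//; last exact: phi_integrable.
  (* [td_laplace] requires a positive exponent; at [n = 0] the integral is the total mass. *)
  congr (_ * _); case: n => [|n].
    by rewrite mul0r addr0 powR1 [LHS]phi0.
  rewrite [LHS]td_laplace//; congr (_ `^ _); congr (_ + _ * _).
  by rewrite /r /gamma_rate invf_div.
have laplaceB (n : nat) :
    \int[leb]_(x in pos) (expR (- (n%:R * x)) * B x) =
    Gamma gamma * (1 + n%:R / r) `^ (- gamma).
  transitivity (\int[leb]_(x in pos) (r `^ gamma * g (r + n%:R) x)).
    apply: eq_Rintegral => y _; rewrite /B /g.
    have -> : - ((r + n%:R) * y) = - (n%:R * y) + - (r * y) by ring.
    by rewrite expRD; ring.
  have [gi gE] := gl _ (rn0 n); rewrite RintegralZl// gE.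
  have -> : 1 + n%:R / r = r^-1 * (r + n%:R).
    by rewrite mulrDr mulVf ?gt_eqF// mulrC.
  rewrite [X in _ = _ * X]powRM ?invr_ge0 ?(ltW r0) ?(ltW (rn0 n))//.
  have -> : r^-1 `^ (- gamma) = r `^ gamma.
    by rewrite -powR_inv1 ?ltW// -powRrM mulN1r opprK.
  by ring.
have cA (y : R) : 0 < y -> {for y, continuous A}.
  move=> y0; apply: cvgMl_tmp.
  exact: (td_continuous_space beta gamma mu h hh).
have cB (y : R) : 0 < y -> {for y, continuous B}.
  move=> y0; apply: cvgMl_tmp; apply: cvgM.
    exact: is_derive_continuous (is_derive1_powR (gamma - 1) y0).
  apply: (@continuous_comp _ _ _ (fun y => - (r * y)) expR).
    by apply: cvgN; apply: cvgMl_tmp; exact: cvg_id.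
  exact: continuous_expR.
(* [laplace0_le0] is one-sided; applied to [f1 - f2] in both orders it gives equality. *)
have le12 (f1 f2 : R -> R) : leb.-integrable pos (EFin \o f1) ->
    leb.-integrable pos (EFin \o f2) ->
    (forall n : nat, \int[leb]_(x in pos) (expR (- (n%:R * x)) * f1 x) =
      \int[leb]_(x in pos) (expR (- (n%:R * x)) * f2 x)) ->
    {for x, continuous f1} -> {for x, continuous f2} -> f1 x <= f2 x.
  move=> i1 i2 e12 c1 c2.
  rewrite -subr_le0; apply: (laplace0_le0 (fun x => f1 x - f2 x)) => //.
  - have m2 : leb.-integrable pos (EFin \o (fun x => -1 * f2 x)).
      exact: (integrable_EFin_mull leb pos).
    have -> : (fun x => f1 x - f2 x) = (fun x => f1 x + -1 * f2 x).
      by apply/funext => y; rewrite mulN1r.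
    by apply: (integrable_EFin_add leb pos).
  - move=> n; transitivity (\int[leb]_(x in pos)
        (expR (- (n%:R * x)) * f1 x - expR (- (n%:R * x)) * f2 x)).
      by apply: eq_Rintegral => y _; rewrite mulrBr.
    by rewrite RintegralB ?e12 ?subrr//; exact: integrable_laplace.
  - exact: cvgB.
apply/eqP; rewrite eq_le; apply/andP; split.
- apply: (le12 A B) => //; [|exact: cA|exact: cB].
  by move=> n; rewrite laplaceA laplaceB.
- apply: (le12 B A) => //; [|exact: cB|exact: cA].
  by move=> n; rewrite laplaceA laplaceB.
Qed.

Lemma gamma_rate_cvg : gamma_rate t @[t --> +oo] --> `|beta| / mu.
Proof.
have e0 : expR (beta * t) @[t --> +oo] --> (0 : R).
  have -> : (fun t => expR (beta * t)) =
      (fun z => expR (- z)) \o (fun t => - beta * t).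
    by apply/funext => t /=; rewrite mulNr opprK.
  apply: (@cvg_comp _ _ _ _ _ _ (pinfty_nbhs R)); last exact: cvgr_expR.
  by apply: gt0_cvgMry; [rewrite oppr_gt0|exact: cvg_id].
rewrite ltr0_norm// /gamma_rate; apply: cvgMl_tmp.
apply: cvgV; first exact: lt0r_neq0.
rewrite -[X in _ --> X]mulr1; apply: cvgMl_tmp.
rewrite -[X in _ --> X]subr0; apply: cvgB => //; exact: cvg_cst.
Qed.

End laplace_transform.

(** * Passage to the limit in the explicit density *)

Theorem corollary6p1 (R : realType) (gamma mu beta : R) (h : R -> R -> R)
    (hgamma : 0 < gamma) (hmu : 0 < mu) (hbeta : beta < 0)
    (hh : transition_density_from0 beta gamma mu h) (x : R) (hx : 0 < x) :
  h x t @[t --> +oo] -->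
    (Gamma gamma)^-1 * (`|beta| / mu) `^ gamma * x `^ (gamma - 1)
      * expR (- (x * (`|beta| / mu))).
Proof.
pose r := gamma_rate beta mu.
have hE t : 0 < t -> Gamma gamma * h x t =
    r t `^ gamma * (x `^ (gamma - 1) * expR (- (r t * x))).
  exact: td_gamma_density.
(* If it vanished, the density identity at time 1 would equate 0 with a positive number. *)
have G0 : Gamma gamma != 0.
  apply/eqP => G0; have := hE 1 ltr01; rewrite G0 mul0r => /esym/eqP.
  by rewrite gt_eqF// !mulr_gt0 ?powR_gt0 ?expR_gt0// gamma_rate_gt0.
have rl : r t @[t --> +oo] --> `|beta| / mu by exact: gamma_rate_cvg.
have l0 : 0 < `|beta| / mu by rewrite divr_gt0// normr_gt0 lt_eqF.
have cl : (Gamma gamma)^-1 * (r t `^ gamma * (x `^ (gamma - 1)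
      * expR (- (r t * x)))) @[t --> +oo] -->
    (Gamma gamma)^-1 * ((`|beta| / mu) `^ gamma * (x `^ (gamma - 1)
      * expR (- (`|beta| / mu * x)))).
  apply: cvgMl_tmp; apply: cvgM.
    apply: (@cvg_comp _ _ _ r (fun z => z `^ gamma) _ _ _ rl).
    exact: is_derive_continuous (is_derive1_powR gamma l0).
  apply: cvgMl_tmp.
  have rx : - (r t * x) @[t --> +oo] --> - (`|beta| / mu * x).
    by apply: cvgN; apply: cvgMr_tmp; exact: rl.
  apply: (@cvg_comp _ _ _ (fun t => - (r t * x)) expR _ _ _ rx).
  exact: continuous_expR.
rewrite -!mulrA [x * _]mulrC; apply: cvg_trans cl.
apply: near_eq_cvg; near=> t.
have t0 : 0 < t by near: t; exact: nbhs_pinfty_gt.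
by rewrite -(hE t t0) mulKf.
Unshelve. all: by end_near. Qed.
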